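(* Let $T\sim\{X_n\}_{n=1}^\infty$ be a random weighted shift on $\mathcal H$ with $X_1$ non-degenerate and $\mathbb P(X_1=0)=0$, and let $R=\max\operatorname{essran}X_1$. Then: (i) $T^*$ is almost surely supercyclic; (ii) $\mathbb P(T^*\text{ is hypercyclic})=1$ if $\mathbb E(\ln X_1)\ge0$, and $=0$ if $\mathbb E(\ln X_1)<0$; (iii) $\mathbb P(T^*\text{ is Li--Yorke chaotic})=1$ if $R>1$, and $=0$ if $R\le1$; (iv) $\mathbb P(T^*\text{ is topologically mixing})=1$ if $\mathbb E(\ln X_1)>0$, and $=0$ if $\mathbb E(\ln X_1)\le0$; (v) $\mathbb P(T^*\text{ is chaotic})=\mathbb P(T^*\text{ is frequently hypercyclic})$, and this common value is $1$ if $\mathbb E(\ln X_1)>0$ and $0$ if $\mathbb E(\ln X_1)\le0$.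
   Context: $\mathcal H$ is a complex separable infinite-dimensional Hilbert space with orthonormal basis $\{e_n\}_{n=1}^\infty$. $\{X_n\}_{n=1}^\infty$ are nonnegative, bounded, i.i.d. random variables on a probability space $(\Omega,\mathcal F,\mathbb P)$. Writing $T\sim\{X_n\}$ means that $T=T(\omega)$ is the random unilateral weighted shift $T(\omega)e_n=X_n(\omega)e_{n+1}$, $n\ge1$. $\operatorname{essran}X_1$ is the essential range of $X_1$ (closed support of its law); $X_1$ is non-degenerate if $\operatorname{essran}X_1$ has more than one point. $\mathbb E(\ln X_1)\in[-\infty,\infty)$. For $A\in\mathcal B(\mathcal H)$: - $A$ is supercyclic if $\{\lambda A^nx:\lambda\in\mathbb C,n\ge0\}$ is dense in $\mathcal H$ for some $x$; hypercyclic if $\{A^ny:n\ge0\}$ is dense for some $y$. - $\{x,y\}$ is a Li–Yorke chaotic pair for $A$ if $\limsup_n\|A^n(x-y)\|>0$ and $\liminf_n\|A^n(x-y)\|=0$; $A$ is Li–Yorke chaotic if there is an uncountable $G\subset\mathcal H$ such that every pair of distinct points of $G$ is a Li–Yorke chaotic pair. - $A$ is topologically mixing if for any nonempty open $G_1,G_2\subset\mathcal H$ there is a positive integer $n$ with $A^m(G_1)\cap G_2\ne\emptyset$ for every $m\ge n$. - $A$ is sensitive if there is $\delta>0$ such that for any $x\in\mathcal H$ and any neighborhood $G$ of $x$ there are $y\in G$ and $n\ge0$ with $\|A^nx-A^ny\|\ge\delta$. - $A$ is chaotic if (1) for each pair of nonempty open $G_1,G_2$ there is $n\in\mathbb N$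 with $A^n(G_1)\cap G_2\ne\emptyset$; (2) $A$ has a dense set of periodic points ($A^kx=x$ for some $k\ge1$); (3) $A$ is sensitive. - $A$ is frequently hypercyclic if there is $x\in\mathcal H$ such that for every nonempty open $G\subset\mathcal H$ the set $\Lambda=\{k\in\mathbb N:A^kx\in G\}$ has positive lower density $\liminf_{n\to\infty}\operatorname{card}(\Lambda\cap[1,n])/n>0$. *)

(* Defs.v *)
From HB Require Import structures.
From mathcomp Require Export all_boot all_order all_algebra.
From mathcomp.real_closed Require Export complex.
From mathcomp Require Export all_classical all_reals all_analysis.
Export numFieldNormedType.Exports.

Set Implicit Arguments.
Unset Strict Implicit.
Unset Printing Implicit Defensive.

Import Order.TTheory GRing.Theory Num.Theory.

Local Open Scope classical_set_scope.
Local Open Scope complex_scope.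
Local Open Scope ring_scope.

Section Hilbert.
Context {R : realType} {V : completeNormedModType R[i]}.

(* The norm of V takes its values in R[i]; this is the same norm, seen in R. *)
Definition rnorm (x : V) : R := complex.Re `|x|.

(* The norm of the Banach space V is induced by the inner product dot
   (linear in its first argument), i.e., V is a complex Hilbert space. *)
Definition induces_norm (dot : {dot V for Num.conj}) : Prop :=
  forall x : V, `|x| ^+ 2 = dot x x.

Definition orthonormal_basis (dot : {dot V for Num.conj}) (e : nat -> V) : Prop :=
  (forall m n, dot (e m) (e n) = (m == n)%:R) /\
  dense [set x : V | exists n (c : nat -> R[i]), x = \sum_(k < n) c k *: e k].

Definition is_adjoint (dot : {dot V for Num.conj}) (A B : V -> V) : Prop :=
  forall x y, dot (A x) y = dot x (B y).

(* Bounded unilateral weighted shift; the index 0 stands for the usual 1. *)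
Definition weighted_shift (e : nat -> V) (w : nat -> R)
    (A : {linear V -> V}) : Prop :=
  continuous A /\ forall n, A (e n) = (w n)%:C *: e n.+1.

Implicit Type A : V -> V.

Definition supercyclic A : Prop :=
  exists x, dense [set y | exists (l : R[i]) (n : nat), y = l *: iter n A x].

Definition hypercyclic A : Prop :=
  exists x, dense [set y | exists n : nat, y = iter n A x].

Definition li_yorke_pair A (x y : V) : Prop :=
  (0 < limn_esup (fun n => (rnorm (iter n A (x - y)))%:E))%E /\
  limn_einf (fun n => (rnorm (iter n A (x - y)))%:E) = 0%E.

Definition li_yorke_chaotic A : Prop :=
  exists G : set V, ~ countable G /\
    forall x y, G x -> G y -> x <> y -> li_yorke_pair A x y.

Definition topologically_mixing A : Prop :=
  forall G1 G2 : set V, open G1 -> open G2 -> G1 !=set0 -> G2 !=set0 ->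
  exists2 n, (0 < n)%N &
    forall m, (n <= m)%N -> (iter m A @` G1) `&` G2 !=set0.

Definition topologically_transitive A : Prop :=
  forall G1 G2 : set V, open G1 -> open G2 -> G1 !=set0 -> G2 !=set0 ->
  exists2 n, (0 < n)%N & (iter n A @` G1) `&` G2 !=set0.

Definition periodic_point A (x : V) : Prop :=
  exists2 k, (0 < k)%N & iter k A x = x.

Definition sensitive A : Prop :=
  exists2 delta : R, 0 < delta &
    forall (x : V) (G : set V), nbhs x G ->
    exists y n, G y /\ delta <= rnorm (iter n A x - iter n A y).

Definition chaotic A : Prop :=
  [/\ topologically_transitive A, dense (periodic_point A) & sensitive A].

Definition lower_density (L : set nat) : \bar R :=
  limn_einf (fun n => ((count (fun k => k \in L) (iota 1 n))%:R / n%:R)%:E).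

Definition frequently_hypercyclic A : Prop :=
  exists x, forall G : set V, open G -> G !=set0 ->
    (0 < lower_density [set k | G (iter k A x)])%E.

End Hilbert.

Section Probability.
Context {d : measure_display} {Omega : measurableType d} {R : realType}.
Variable P : probability Omega R.

Definition identically_distributed (X : nat -> {RV P >-> R}) : Prop :=
  forall n (B : set R), measurable B ->
    distribution P (X n) B = distribution P (X 0%N) B.

Definition mutually_independent (X : nat -> {RV P >-> R}) : Prop :=
  forall (J : seq nat) (B : nat -> set R), uniq J ->
    (forall j, measurable (B j)) ->
    P [set w | forall j, j \in J -> B j (X j w)] =
    (\prod_(j <- J) P (X j @^-1` B j))%E.

(* Essential range: the closed support of the law of X. *)
Definition essran (X : {RV P >-> R}) : set R :=
  [set x | forall U : set R, open U -> U x -> (0 < distribution P X U)%E].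

Definition nondegenerate_rv (X : {RV P >-> R}) : Prop :=
  exists x y, [/\ essran X x, essran X y & x <> y].

(* P(E) = p with respect to the completion of P, so that E, which need not
   belong to the given sigma-algebra, is only required to differ from a
   measurable set by a P-negligible one. *)
Definition has_prob (E : set Omega) (p : \bar R) : Prop :=
  exists F : set Omega,
    [/\ measurable F, P.-negligible (E `\` F), P.-negligible (F `\` E)
      & P F = p].

End Probability.

(* Main.v *)
From HB Require Import structures.
Require Import Defs.
From mathcomp Require Import measurable_realfun ring lra zify.

(** The adjoint B of the shift kills e_0 and sends e_(n+1) to X_n e_n. In the rescaled
    basis e_n / W_n, where W_n is the product of the first n weights, B is the
    unweighted shift; its dynamics is therefore decided by the size of the W_n, and
    ln W_n is a random walk with steps distributed as ln X_0.

    For a fixed sequence of positive weights bounded by M: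
    - B is supercyclic (supercyclic_shift), and hypercyclic if the W_n are unbounded
      (hypercyclic_shift), by Baire category: a word written far out is a small vector
      which B carries back to the front. If the W_n are bounded, so is the first
      coordinate along every orbit (not_hypercyclic_shift).
    - If blocks of consecutive weights have unbounded products, category also gives a
      vector with an irregular orbit, whose real multiples are a Li-Yorke scrambled
      set (li_yorke_shift); if all weights are at most 1, the norms decrease along
      orbits and no such set exists (not_li_yorke_contraction).
    - If W_n grows exponentially, periodic words give dense periodic points
      (chaotic_shift), and a concatenation of words, in which each word returns with
      positive density and is given room in proportion to its complexity, is a
      frequently hypercyclic vector (frequently_hypercyclic_shift).
    - Mixing, chaos and frequent hypercyclicity all force W_n to stay away from 0
      (mixing_inf_gt0, chaotic_inf_gt0, frequently_hypercyclic_inf_gt0). For frequent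
      hypercyclicity this rests on the fact that the differences of a set of positive
      lower density have bounded gaps (difference_syndetic).

    It remains to see that almost surely the walk ln W_n grows linearly if its mean is
    positive, decreases linearly if it is negative, and is unbounded on both sides if
    it is zero. The sequence of weights is a Bernoulli shift: its first term and the
    remaining sequence are independent, and the latter has the law of the whole. The
    maximum S of the partial sums satisfies S = max (0, f + S'), with f the first step
    and S' the maximum for the remaining sequence. Comparing the expectations of the
    two sides shows that the sums are bounded above if the drift is negative
    (sup_finite_of_neg_drift) and unbounded above if it is zero and the steps do not
    vanish (sup_infinite_of_zero_drift); shifting the steps by a constant turns the
    first statement into linear growth. Finally, if the maximum r of the essential
    range exceeds 1, arbitrarily long runs of weights above some c > 1 occur
    (no_run_null), which provides the blocks with large products. *)

Set Implicit Arguments.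
Unset Strict Implicit.
Unset Printing Implicit Defensive.
Import Order.TTheory GRing.Theory Num.Theory.
Local Open Scope classical_set_scope.
Local Open Scope complex_scope.
Local Open Scope ring_scope.

(** * The norm with real values *)

Section RealNorm.
Context {R : realType} {V : completeNormedModType R[i]}.
Implicit Types (x y : V) (a : R[i]).

Lemma norm_rnorm x : `|x| = (rnorm x)%:C.
Proof. by rewrite /rnorm RRe_real// normr_real. Qed.

Lemma norm_normc a : `|a| = (ComplexField.Normc.normc a)%:C.
Proof. by rewrite normc_def; case: a. Qed.

Lemma rnorm_ge0 x : 0 <= rnorm x.
Proof. by rewrite -lecR -norm_rnorm normr_ge0. Qed.

Lemma rnorm0 : rnorm (0 : V) = 0.
Proof. by rewrite /rnorm normr0. Qed.

Lemma rnorm_eq0 x : rnorm x = 0 -> x = 0.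
Proof. by move=> h; apply/normr0_eq0; rewrite norm_rnorm h. Qed.

Lemma rnormN x : rnorm (- x) = rnorm x.
Proof. by rewrite /rnorm normrN. Qed.

Lemma rnormC x y : rnorm (x - y) = rnorm (y - x).
Proof. by rewrite -rnormN opprB. Qed.

Lemma rnormD x y : rnorm (x + y) <= rnorm x + rnorm y.
Proof. by rewrite -lecR rmorphD/= -!norm_rnorm ler_normD. Qed.

Lemma rnorm_tri z x y : rnorm (x - y) <= rnorm (x - z) + rnorm (z - y).
Proof. by rewrite (le_trans _ (rnormD _ _))// addrA subrK. Qed.

Lemma rnormZ a x : rnorm (a *: x) = ComplexField.Normc.normc a * rnorm x.
Proof.
by apply: (@complexI R); rewrite rmorphM/= -!norm_rnorm normrZ norm_normc.
Qed.

Lemma normc_real (t : R) : ComplexField.Normc.normc t%:C = `|t|.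
Proof. by rewrite /= expr0n/= addr0 sqrtr_sqr. Qed.

Lemma normc_ge0 (a : R[i]) : 0 <= ComplexField.Normc.normc a.
Proof. by case: a => b c /=; exact: sqrtr_ge0. Qed.

Lemma normc_triangle (a b : R[i]) : ComplexField.Normc.normc (a + b) <=
  ComplexField.Normc.normc a + ComplexField.Normc.normc b.
Proof. exact: le_normcD. Qed.

Lemma normc_opp (a : R[i]) :
  ComplexField.Normc.normc (- a) = ComplexField.Normc.normc a.
Proof. by apply: (@complexI R); rewrite -!norm_normc normrN. Qed.

Lemma rnormZr (t : R) x : rnorm (t%:C *: x) = `|t| * rnorm x.
Proof. by rewrite rnormZ normc_real. Qed.

Lemma rnorm_sum (I : Type) (r : seq I) (P : pred I) (F : I -> V) :
  rnorm (\sum_(i <- r | P i) F i) <= \sum_(i <- r | P i) rnorm (F i).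
Proof.
elim/big_ind2 : _ => //; first by rewrite rnorm0.
by move=> u a v b ua vb; rewrite (le_trans (rnormD _ _))// lerD.
Qed.

(** Balls of V have radii in R[i], of which only the positive reals matter. *)
Lemma nbhs_rnormP x (G : set V) :
  nbhs x G <-> exists2 eps : R, 0 < eps & forall y, rnorm (x - y) < eps -> G y.
Proof.
split=> [/nbhs_normP[/= eps eps0 epsG]|[eps eps0 epsG]].
  have epsE : (complex.Re eps)%:C = eps by rewrite RRe_real// gtr0_real.
  exists (complex.Re eps); first by rewrite -ltcR epsE.
  by move=> y xy; apply: epsG => /=; rewrite norm_rnorm -epsE ltcR.
apply/nbhs_normP; exists eps%:C => /=; first by rewrite ltcR.
by move=> y /=; rewrite norm_rnorm ltcR; exact: epsG.
Qed.

Lemma open_rnormP (G : set V) x : open G -> G x ->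
  exists2 eps : R, 0 < eps & forall y, rnorm (x - y) < eps -> G y.
Proof.
by move=> oG Gx; apply/nbhs_rnormP; move: oG; rewrite openE; exact.
Qed.

Lemma open_rball x (eps : R) : open [set y | rnorm (x - y) < eps].
Proof.
rewrite openE => y /= xy; apply/nbhs_rnormP; exists (eps - rnorm (x - y)).
  by rewrite subr_gt0.
move=> z yz /=; rewrite (le_lt_trans (rnorm_tri y _ _))//.
by rewrite -ltrBrDl.
Qed.

Lemma denseP (D : set V) :
  dense D <-> forall x (eps : R), 0 < eps -> exists2 y, D y & rnorm (x - y) < eps.
Proof.
split=> [dD x eps eps0|dD G [x Gx] oG].
  have [||y [/= xy Dy]] := dD [set y | rnorm (x - y) < eps].
  - by exists x => /=; rewrite subrr rnorm0.
  - exact: open_rball.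
  - by exists y.
have [eps eps0 xG] := open_rnormP oG Gx.
by have [y Dy xy] := dD x eps eps0; exists y; split => //; exact: xG.
Qed.

Lemma small_geometric (C rho eps : R) : 0 <= rho -> rho < 1 -> 0 < eps ->
  exists N, forall n, (N <= n)%N -> C * rho ^+ n < eps.
Proof.
move=> r0 r1 eps0.
have rho_cvg : (fun n => C * rho ^+ n) @ \oo --> (0 : R).
  rewrite -[X in _ --> X](mulr0 C); apply: cvgM; first exact: cvg_cst.
  by apply: cvg_expr; rewrite ger0_norm.
have /cvgrPdist_lt/(_ _ eps0)[N _ hN] := rho_cvg; exists N => n /hN /=.
by rewrite sub0r normrN; apply: le_lt_trans; exact: ler_norm.
Qed.

(** Completeness, with an explicit rate: it sums the series of words used below
    and yields the limit of the nested balls in Baire's theorem. *)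
Lemma geometric_limit (u : nat -> V) (C rho : R) : 0 <= rho -> rho < 1 ->
  (forall n, rnorm (u n.+1 - u n) <= C * rho ^+ n) ->
  exists x, forall n, rnorm (x - u n) <= C / (1 - rho) * rho ^+ n.
Proof.
move=> r0 r1 hu.
have C0 : 0 <= C by have := hu 0%N; rewrite expr0 mulr1; apply: le_trans; exact: rnorm_ge0.
have r1' : 0 < 1 - rho by rewrite subr_gt0.
have tail n k : rnorm (u (n + k)%N - u n) <= C / (1 - rho) * rho ^+ n * (1 - rho ^+ k).
  elim: k => [|k ih]; first by rewrite addn0 subrr rnorm0 expr0 subrr mulr0.
  apply: (le_trans (rnorm_tri (u (n + k)%N) _ _)).
  rewrite addnS (le_trans (lerD (hu _) ih))// le_eqVlt; apply/orP; left; apply/eqP.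
  by rewrite exprD exprS; field; rewrite subr_eq0 gt_eqF.
have tail' n m : (n <= m)%N -> rnorm (u m - u n) <= C / (1 - rho) * rho ^+ n.
  move=> nm; rewrite -(subnKC nm) (le_trans (tail _ _))// ler_piMr//.
    by rewrite mulr_ge0 ?exprn_ge0// divr_ge0// ltW.
  by rewrite gerBl exprn_ge0.
have /cauchy_cvgP ucvg : cauchy (u @ \oo).
  apply/cauchy_exP => /= eps eps0.
  have epsE : (complex.Re eps)%:C = eps by rewrite RRe_real// gtr0_real.
  have eps0' : 0 < complex.Re eps by rewrite -ltcR epsE.
  have [N hN] := small_geometric (C / (1 - rho)) r0 r1 eps0'.
  exists (u N); exists N => // m /= Nm.
  rewrite -ball_normE /= norm_rnorm -epsE ltcR rnormC.
  exact: le_lt_trans (tail' _ _ Nm) (hN N (leqnn N)).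
exists (lim (u @ \oo)) => n; rewrite leNgt; apply/negP => h.
set x := lim _ in h.
have : nbhs x [set y | rnorm (x - y) < rnorm (x - u n) - C / (1 - rho) * rho ^+ n].
  by apply/nbhs_rnormP; eexists; last (by move=> y; apply); rewrite subr_gt0.
move=> /ucvg[N _ /(_ (maxn n N))] /=; rewrite leq_maxr => /(_ isT) {}h.
have := rnorm_tri (u (maxn n N)) x (u n).
have := tail' n (maxn n N) (leq_maxl _ _); lra.
Qed.

(** Nested balls whose radii decrease by a factor 4: the centres converge so fast
    that the limit stays within twice the radius of each ball. *)
Lemma baire_point (F : nat -> set V) :
  (forall i, open (F i)) -> (forall i, dense (F i)) -> exists x, forall i, F i x.
Proof.
move=> oF dF.
pose next i (p q : V * R) := [/\ 0 < q.2, q.2 <= p.2 / 4,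
  rnorm (q.1 - p.1) <= p.2 / 4 & forall y, rnorm (q.1 - y) <= q.2 *+ 2 -> F i y].
have step (ip : nat * (V * R)) : exists q, 0 < ip.2.2 -> next ip.1 ip.2 q.
  case: ip => i [x r] /=; have [r0|] := ltP 0 r; last by move=> _; exists (x, r).
  have r4 : 0 < r / 4 by rewrite divr_gt0.
  have /denseP/(_ x _ r4)[y Fy xy] := dF i.
  have [eps eps0 yF] := open_rnormP (oF i) Fy.
  exists (y, Num.min (r / 4) (eps / 4)) => _; split => /=.
  - by rewrite lt_min r4 divr_gt0.
  - by rewrite ge_min lexx.
  - by rewrite rnormC ltW.
  - move=> z hz; apply: yF; apply: le_lt_trans hz _.
    have : Num.min (r / 4) (eps / 4) <= eps / 4 by rewrite ge_min lexx orbT.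
    by move: (Num.min _ _) => t ht; rewrite mulr2n; lra.
have [f hf] := choice step.
pose p := fix p n := if n is m.+1 then f (m, p m) else (0 : V, 1 : R).
have pos n : 0 < (p n).2.
  elim: n => [|n ih] //=; by have [] := hf (n, p n) ih.
have nxt n : next n (p n) (p n.+1) by exact: (hf (n, p n) (pos n)).
have radD n k : (p (n + k)%N).2 <= (p n).2 * 4^-1 ^+ k.
  elim: k => [|k ih]; first by rewrite addn0 mulr1.
  rewrite addnS; have [_ h _ _] := nxt (n + k)%N; apply: (le_trans h).
  by rewrite exprSr mulrA ler_pM2r.
have q1 : (4^-1 : R) < 1 by rewrite invf_lt1// ltr1n.
have lim_tail n : exists x, forall k, rnorm (x - (p (n + k)%N).1)
    <= (p n).2 / 4 / (1 - 4^-1) * 4^-1 ^+ k.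
  apply: geometric_limit => // k.
  have [_ _ h _] := nxt (n + k)%N; rewrite -addnS in h; apply: (le_trans h).
  by rewrite mulrAC ler_pM2r// radD.
have [x hx] := lim_tail 0%N; exists x => i.
have [_ _ _] := nxt i; apply.
have [x' hx'] := lim_tail i.+1.
(* both are limits of the centres; only the bounds on the distances differ *)
have -> : x = x'.
  apply/eqP; rewrite -subr_eq0; apply/eqP/rnorm_eq0/eqP; rewrite eq_le rnorm_ge0 andbT.
  rewrite leNgt; apply/negP => h.
  set C := (p i.+1).2 / 4 / (1 - 4^-1) in hx'; set C0 := (p 0%N).2 / 4 / (1 - 4^-1) in hx.
  have e0 : 0 < rnorm (x - x') / 2 by rewrite divr_gt0.
  have q0 : 0 <= (4^-1 : R) by rewrite invr_ge0.
  have [N1 h1] := small_geometric C q0 q1 e0.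
  have [N2 h2] := small_geometric C0 q0 q1 e0.
  pose m := maxn N2 N1.
  have := rnorm_tri (p (i.+1 + m)%N).1 x x'.
  have := hx (i.+1 + m)%N; rewrite add0n.
  have := h2 (i.+1 + m)%N (leq_trans (leq_maxl _ _) (leq_addl _ _)).
  have := h1 m (leq_maxr _ _); have := hx' m.
  rewrite [rnorm (x' - _)]rnormC; lra.
have := hx' 0%N; rewrite addn0 mulr1 rnormC => /le_trans; apply.
have := pos i.+1; move: (p i.+1).2 => t t0.
have -> : t / 4 / (1 - 4^-1) = t / 3 by field.
by rewrite mulr2n; lra.
Qed.

End RealNorm.

(** * Universal vectors *)

Section Universality.
Context {R : realType} {V : completeNormedModType R[i]}.

Lemma lipschitz_open (f : V -> V) (L : R) (G : set V) :
  (forall x y, rnorm (f x - f y) <= L * rnorm (x - y)) -> open G -> open (f @^-1` G).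
Proof.
move=> fL oG; rewrite openE => x /= Gfx; apply/nbhs_rnormP.
have [eps eps0 hG] := open_rnormP oG Gfx.
have L0 : 0 < `|L| + 1 by rewrite ltr_wpDl.
exists (eps / (`|L| + 1)); first by rewrite divr_gt0.
move=> y; rewrite ltr_pdivlMr// => xy; apply: hG; apply: le_lt_trans (fL _ _) _.
apply: le_lt_trans xy; rewrite mulrC ler_wpM2l ?rnorm_ge0//.
by rewrite (le_trans (ler_norm _))// lerDl.
Qed.

(** Birkhoff's transitivity argument: the vectors whose orbit meets a given ball
    form a dense open set, and countably many balls are enough. *)
Lemma birkhoff_universal (I : Type) (T : I -> V -> V) (s : nat -> V) :
  (forall i, exists L, forall x y, rnorm (T i x - T i y) <= L * rnorm (x - y)) ->
  (forall x eps, 0 < eps -> exists k, rnorm (x - s k) < eps) ->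
  (forall x y eps, 0 < eps ->
    exists i z, rnorm (x - z) < eps /\ rnorm (y - T i z) < eps) ->
  exists x, dense [set y | exists i, y = T i x].
Proof.
move=> T_lip s_dense T_steer.
pose F n := if @unpickle (nat * nat)%type n is Some (k, m) then
  \bigcup_i (T i @^-1` [set y | rnorm (s k - y) < m.+1%:R^-1]) else setT.
have [i|i|x xF] := @baire_point R V F.
- rewrite /F; case: unpickle => [[k m]|]; last exact: openT.
  apply: bigcup_open => j _; have [L TL] := T_lip j.
  exact: lipschitz_open TL (open_rball _ _).
- rewrite /F; case: unpickle => [[k m]|]; apply/denseP => x eps eps0; last first.
    by exists x; rewrite // subrr rnorm0.
  have e0 : 0 < Num.min eps m.+1%:R^-1 by rewrite lt_min eps0 invr_gt0 ltr0n.
  have [j [z [xz skz]]] := T_steer x (s k) _ e0.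
  exists z; first by exists j => //=; rewrite (lt_le_trans skz)// ge_min lexx orbT.
  by rewrite (lt_le_trans xz)// ge_min lexx.
exists x; apply/denseP => y eps eps0.
have e2 : 0 < eps / 2 by rewrite divr_gt0.
have [k yk] := s_dense y _ e2.
have [m hm] : exists m, m.+1%:R^-1 < eps / 2.
  exists (Num.trunc (eps / 2)^-1).
  by rewrite -ltf_pV2 ?(posrE,invr_gt0,ltr0n)// invrK truncnS_gt.
have := xF (pickle (k, m)); rewrite /F pickleK => -[i _ /= hi].
exists (T i x); first by exists i.
apply: le_lt_trans (rnorm_tri (s k) _ _) _; rewrite (splitr eps) ltrD//.
exact: lt_trans hi hm.
Qed.

End Universality.

(** * Limits inferior and superior *)

Section LimitInferior.
Context {R : realType}.
Implicit Types (u : nat -> \bar R) (c : \bar R).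
Local Open Scope ereal_scope.

Lemma limn_esup_ge u c : (forall N, exists2 n, (N <= n)%N & c <= u n) ->
  c <= limn_esup u.
Proof.
move=> h; apply: le_ereal_inf_tmp => _ [A [N _ NA] <-].
have [n Nn cu] := h N; apply: (le_trans cu); apply: ereal_sup_ubound.
by exists n => //; exact: NA.
Qed.

Lemma limn_esup_le u c N : (forall n, (N <= n)%N -> u n <= c) ->
  limn_esup u <= c.
Proof.
move=> h; apply: (@le_trans _ _ (ereal_sup [set u x | x in [set n | (N <= n)%N]])).
  by apply: ereal_inf_lbound; exists [set n | (N <= n)%N] => //; exists N.
by apply: ge_ereal_sup => _ [n /= Nn <-]; exact: h.
Qed.

Lemma limn_einf_le u c : (forall N, exists2 n, (N <= n)%N & u n <= c) ->
  limn_einf u <= c.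
Proof.
move=> h; rewrite /limn_einf leeNl; apply: limn_esup_ge => N.
by have [n Nn un] := h N; exists n => //; rewrite leeN2.
Qed.

Lemma limn_einf_ge u c N : (forall n, (N <= n)%N -> c <= u n) ->
  c <= limn_einf u.
Proof.
move=> h; rewrite /limn_einf leeNr; apply: (@limn_esup_le _ _ N) => n /h.
by rewrite leeN2.
Qed.

Lemma limn_einf_gt u c : c < limn_einf u ->
  exists N, forall n, (N <= n)%N -> c < u n.
Proof.
apply: contraPP => /forallNP h; rewrite ltNge; apply/negP/negPn.
apply: limn_einf_le => N; have /existsNP[n /not_implyP[Nn /negP]] := h N.
by rewrite -leNgt => ?; exists n.
Qed.

End LimitInferior.

(** * Sets of positive lower density *)

Section LowerDensity.
Context {R : realType}.

(** If no bounded set of shifts of k were enough, arbitrarily many translates of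
    the set would be pairwise disjoint, which its density forbids. *)
Lemma difference_syndetic (A : set nat) : (0 < lower_density A :> \bar R)%E ->
  exists D, forall k, exists a b r, [/\ A a, A b, (r <= D)%N & a = (b + (k + r))%N].
Proof.
move=> A_dens.
pose cnt n := count (fun k => k \in A) (iota 1 n).
have [c c0 [N hN]] : exists2 c : R, 0 < c & exists N, forall n, (N <= n)%N ->
    c * n%:R <= (cnt n)%:R.
  have [c c0 cA] : exists2 c : R, 0 < c & (c%:E < lower_density A)%E.
    case: (lower_density A) A_dens => [r r0| _|//].
      by exists (r / 2); rewrite ?divr_gt0// lte_fin ltr_pdivrMr// mulr_natr mulr2n ltrDl.
    by exists 1 => //; rewrite ltry.
  have [N hN] := limn_einf_gt cA; exists c => //; exists N => -[|n] /hN; first by rewrite mulr0.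
  by rewrite lte_fin ltr_pdivlMr ?ltr0n// => /ltW.
apply: contrapT => /forallNP noD.
pose disj r r' := forall a b, A a -> A b -> (a + r)%N <> (b + r')%N.
pose disjb r r' : bool := `[< disj r r' >].
have fam m : exists2 s, size s = m & pairwise disjb s.
  elim: m => [|m [s sm hs]]; first by exists [::].
  have /existsNP[k hk] := noD (\max_(r <- s) r)%N.
  exists (0%N :: [seq (k + r)%N | r <- s]); rewrite /= ?size_map ?sm//.
  apply/andP; split.
    apply/allP => _ /mapP[r rs ->]; apply/asboolP => a b Aa Ab; rewrite addn0 => ab.
    apply: hk; exists a, b, r; split => //; exact: (@leq_bigmax_seq _ s xpredT id r rs isT).
  rewrite pairwise_map; apply: sub_pairwise hs => r r' /asboolP h; apply/asboolP.
  by move=> a b Aa Ab /eqP; rewrite !(addnCA _ k) eqn_add2l => /eqP; exact: h.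
have [m hm] : exists m : nat, 2 < m%:R * c.
  exists (Num.trunc (2 / c)).+1; rewrite -ltr_pdivrMr//; exact: truncnS_gt.
have [s sm hs] := fam m.
pose D := (\max_(r <- s) r)%N; pose n := (maxn N D).+1.
have cnt_le : (m * cnt n <= n + D)%N.
  pose An := [seq k <- iota 1 n | k \in A].
  have <- : size [seq (a + r)%N | r <- s, a <- An] = (m * cnt n)%N.
    by rewrite size_allpairs sm size_filter.
  rewrite -[leqRHS](size_iota 1); apply: uniq_leq_size; last first.
    move=> _ /allpairsP[[r a] /= [rs + ->]]; rewrite mem_filter !mem_iota => /and3P[_ a1 an].
    have rD : (r <= D)%N by exact: (@leq_bigmax_seq _ s xpredT id r rs isT).
    change (is_true ((a + r)%N \in iota 1 (n + D))); rewrite mem_iota; lia.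
  have An_uniq : uniq An by rewrite filter_uniq// iota_uniq.
  have AnA a : a \in An -> A a by rewrite mem_filter => /andP[/set_mem].
  elim: s hs {sm D n} An An_uniq AnA => //= r s ih /andP[hr hs] An An_uniq AnA.
  rewrite cat_uniq map_inj_uniq ?An_uniq ?ih//=; last by move=> a b /addIn.
  rewrite andbT; apply/hasPn => _ /allpairsP[[r' b] /= [rs bA ->]].
  apply/negP => /mapP[a aA] /esym; move/allP : hr => /(_ _ rs)/asboolP; apply; exact: AnA.
have := hN n; rewrite leqW ?leq_maxl// => /(_ isT) hn.
have : m%:R * (c * n%:R) <= (n + D)%:R.
  by rewrite (le_trans _ (_ : (m * cnt n)%:R <= _)) ?ler_nat// natrM ler_wpM2l.
have Dn : (D%:R : R) <= n%:R by rewrite ler_nat /n leqW// leq_maxr.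
have n0 : (0 : R) < n%:R by rewrite ltr0n.
have : 2 * n%:R < m%:R * c * n%:R by rewrite ltr_pM2r.
rewrite natrD mulrA; lra.
Qed.
(** Linear growth leaves at least n / c distinct values of g up to n. *)
Lemma lower_density_gt0 (A : set nat) (g : nat -> nat) (c : nat) : injective g ->
  (forall t, A (g t)) -> (forall t, 0 < g t <= c * t.+1)%N ->
  (0 < lower_density A :> \bar R)%E.
Proof.
move=> g_inj gA gc.
have c0 : (0 < c)%N by have := gc 0%N; rewrite muln1 => /andP[]; exact: leq_trans.
apply: (@lt_le_trans _ _ ((2 * c)%:R^-1)%:E).
  by rewrite lte_fin invr_gt0 ltr0n muln_gt0.
apply: (@limn_einf_ge _ _ _ c) => n cn; rewrite lee_fin.
have n0 : (0 < n)%N by exact: leq_trans cn.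
have h : (n %/ c <= count (fun k => k \in A) (iota 1 n))%N.
  rewrite -size_filter -[leqLHS](size_iota 0) -(size_map g).
  apply: uniq_leq_size; first by rewrite map_inj_uniq// iota_uniq.
  move=> _ /mapP[t + ->]; rewrite mem_iota add0n => /= tn.
  rewrite mem_filter mem_iota mem_set//=; have /andP[-> gct] := gc t.
  rewrite add1n ltnS (leq_trans gct)// mulnC (leq_trans _ (leq_trunc_div n c))//.
  by rewrite leq_mul2r tn orbT.
rewrite ler_pdivlMr ?ltr0n// mulrC ler_pdivrMr ?ltr0n ?muln_gt0// -natrM ler_nat.
apply: (@leq_trans (n %/ c * (2 * c))); last by rewrite leq_mul2r h orbT.
have := ltn_pmod n c0; have := divn_eq n c; have : (0 < n %/ c)%N by rewrite divn_gt0.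
move: (n %/ c)%N (n %% c)%N => q r; nia.
Qed.

End LowerDensity.

(** * Ruler sequence *)

(** The ruler sequence takes each value with positive density although its
    partial sums grow only linearly. *)
Definition label (j : nat) := logn 2 j.+1.

(** The sum is the 2-adic valuation of j!, which Legendre's formula bounds. *)
Lemma sum_label j : (\sum_(i < j) label i <= j)%N.
Proof.
have -> : (\sum_(i < j) label i = logn 2 j`!)%N.
  elim: j => [|j ih]; first by rewrite big_ord0 logn1.
  by rewrite big_ord_recr ih factS lognM ?fact_gt0// addnC.
rewrite logn_fact//.
have h n : (\sum_(1 <= k < n.+1) j %/ 2 ^ k + j %/ 2 ^ n <= j)%N.
  elim: n => [|n ih]; first by rewrite big_nil expn0 divn1.
  rewrite big_nat_recr//= -addnA; apply: leq_trans ih; rewrite leq_add2l.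
  by rewrite addnn -muln2 expnSr divnMA leq_trunc_div.
by apply: leq_trans (h j); rewrite leq_addr.
Qed.

(** Where the j-th word starts when it is given room for its label on both sides. *)
Definition start (j : nat) := (\sum_(i < j) (label i).*2.+1 + label j)%N.

(** Between the starts of two words lies the room of both, and one more place for
    each step: this kills the earlier word and damps the later one. *)
Lemma start_gap i t : (0 < t)%N ->
  (start i + label i + label (i + t) + t <= start (i + t))%N.
Proof.
case: t => // t _; rewrite /start.
have h : (\sum_(k < i) (label k).*2.+1 + (label i).*2 + t.+1
    <= \sum_(k < i + t.+1) (label k).*2.+1)%N.
  elim: t => [|t ih]; first by rewrite (addn1 i) big_ord_recr/=; lia.
  rewrite (addnS i t.+1) big_ord_recr/= [leqLHS]addnS -[leqLHS]addn1; exact: leq_add.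
by lia.
Qed.

Lemma start_ge j : (label j + j <= start j)%N.
Proof.
case: j => [|j]; first by rewrite addn0 leq_addl.
by have := @start_gap 0 j.+1 isT; rewrite add0n; lia.
Qed.

Lemma start_early i j : (j < i)%N -> ((label j).+1 + start j <= start i)%N.
Proof.
move=> ji; have := @start_gap j (i - j).
by rewrite subn_gt0 ji subnKC ?(ltnW ji)// => /(_ isT); lia.
Qed.

Lemma start_late i t :
  (label (i + t.+1) + (label i + t.+1) <= start (i + t.+1) - start i)%N.
Proof. by have := @start_gap i t.+1 isT; lia. Qed.

Lemma start_mono i t : (start i <= start (i + t))%N.
Proof. by case: t => [|t]; [rewrite addn0|have := @start_gap i t.+1 isT; lia]. Qed.

Lemma start_le j : (start j <= 3 * j.+1)%N.
Proof.
have : (start j + label j <= \sum_(i < j.+1) (label i).*2.+1)%N.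
  by rewrite big_ord_recr/= /start -addnA addnn leq_add2l.
have -> : (\sum_(i < j.+1) (label i).*2.+1 = (\sum_(i < j.+1) label i).*2 + j.+1)%N.
  elim: j.+1 => [|k ih]; first by rewrite !big_ord0.
  by rewrite !big_ord_recr/= ih; move: (bigop _ _ _) (label _) => a b; lia.
have := sum_label j.+1; lia.
Qed.

Lemma start_inj : injective start.
Proof.
have lt i j : (i < j)%N -> (start i < start j)%N.
  move=> ij; have := @start_gap i (j - i); rewrite subnKC ?(ltnW ij)// subn_gt0 ij.
  by move=> /(_ isT); have := ij; lia.
move=> i j; case: (ltngtP i j) => // /lt; lia.
Qed.

(** The indices with label l are 2 ^ l (2 t + 1) - 1. The next lemmas leave out t = 0,
    which for l = 0 gives the index 0, where start vanishes. *)
Lemma label_dyadic l t : label (2 ^ l * t.*2.+1).-1 = l.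
Proof.
rewrite /label prednK ?muln_gt0 ?expn_gt0// lognM ?expn_gt0// pfactorK//.
by rewrite lognE/= dvdn2/= odd_double/= addn0.
Qed.

Lemma start_dyadic_inj l : injective (fun t => start (2 ^ l * t.+1.*2.+1).-1).
Proof.
move=> t t' /start_inj; have P0 : (0 < 2 ^ l)%N by rewrite expn_gt0.
move=> /(congr1 succn); rewrite !prednK ?muln_gt0 ?P0// => /eqP.
by rewrite eqn_pmul2l// => /eqP; lia.
Qed.

Lemma start_dyadic l t :
  (0 < start (2 ^ l * t.+1.*2.+1).-1 <= (9 * 2 ^ l) * t.+1)%N.
Proof.
set i := (_ * _).-1; have P0 : (0 < 2 ^ l)%N by rewrite expn_gt0.
have i0 : (0 < i)%N by rewrite /i; nia.
rewrite (leq_trans i0) ?(leq_trans _ (start_ge i)) ?leq_addl//=.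
apply: (leq_trans (start_le i)); rewrite /i prednK ?muln_gt0 ?P0//; nia.
Qed.

(** * Coordinates in an orthonormal basis *)

Section OrthonormalBasis.
Context {R : realType} {V : completeNormedModType R[i]}.
Variables (dot : {dot V for Num.conj}) (e : nat -> V).
Hypotheses (hdot : induces_norm dot) (he : orthonormal_basis dot e).
Local Notation normc := ComplexField.Normc.normc.

Lemma dot_conj x y : dot x y = Num.conj (dot y x).
Proof. by rewrite hermC expr0 mul1r. Qed.

Lemma dotBl x y z : dot (x - y) z = dot x z - dot y z.
Proof. exact: linearBl. Qed.

Lemma dotBr x y z : dot x (y - z) = dot x y - dot x z.
Proof. exact: linearBr. Qed.

Lemma dotZl a x y : dot (a *: x) y = a * dot x y.
Proof. exact: linearZl_LR. Qed.

Lemma dotZr a x y : dot x (a *: y) = Num.conj a * dot x y.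
Proof. exact: linearZr_LR. Qed.

Lemma rnorm_dot x : (rnorm x ^+ 2)%:C = dot x x.
Proof. by rewrite rmorphXn/= -norm_rnorm hdot. Qed.

(** The component u of x orthogonal to y has a nonnegative norm. *)
Lemma cauchy_schwarz x y : normc (dot x y) <= rnorm x * rnorm y.
Proof.
have [->|y0] := eqVneq y 0.
  by rewrite linear0r ComplexField.Normc.normc0 mulr_ge0 ?rnorm_ge0.
have ry0 : 0 < rnorm y.
  rewrite lt_neqAle rnorm_ge0 andbT eq_sym; apply/eqP => /rnorm_eq0 h.
  by rewrite h eqxx in y0.
have dy0 : dot y y != 0.
  by rewrite -rnorm_dot; apply/eqP => -[/eqP]; rewrite expf_eq0 gt_eqF.
pose u := x - (dot x y / dot y y) *: y.
have : rnorm u ^+ 2 * rnorm y ^+ 2 = rnorm x ^+ 2 * rnorm y ^+ 2 - normc (dot x y) ^+ 2.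
  apply: (@complexI R); rewrite rmorphB !rmorphM/= -!expr2 -!rmorphXn/=.
  rewrite !rnorm_dot rmorphXn/= -norm_normc normCK.
  have cy : Num.conj (dot y y) = dot y y by rewrite -dot_conj.
  rewrite /u !(dotBl, dotBr, dotZl, dotZr) rmorphM/= fmorphV/= -!dot_conj.
  by field.
have : 0 <= rnorm u ^+ 2 * rnorm y ^+ 2 by rewrite mulr_ge0// sqr_ge0.
move=> h1 h2; rewrite h2 subr_ge0 -exprMn in h1.
by rewrite -(@ler_pXn2r _ 2)// nnegrE ?normc_ge0// mulr_ge0// rnorm_ge0.
Qed.

Definition coord n x : R[i] := dot x (e n).

Lemma coordB n x y : coord n (x - y) = coord n x - coord n y.
Proof. by rewrite /coord linearBl. Qed.
Lemma coordZ n a x : coord n (a *: x) = a * coord n x.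
Proof. by rewrite /coord dotZl. Qed.
Lemma coord0 n : coord n 0 = 0.
Proof. by rewrite /coord linear0l. Qed.

Lemma coord_basis m n : coord m (e n) = (n == m)%:R.
Proof. by rewrite /coord he.1. Qed.

Lemma rnorm_basis n : rnorm (e n) = 1.
Proof.
have : (rnorm (e n) ^+ 2)%:C = 1 by rewrite rnorm_dot he.1 eqxx.
by move=> [/eqP]; rewrite sqrp_eq1 ?rnorm_ge0// => /eqP.
Qed.

Lemma coord_le n x : normc (coord n x) <= rnorm x.
Proof. by have := cauchy_schwarz x (e n); rewrite rnorm_basis mulr1. Qed.

Lemma span_dense (x : V) (eps : R) : 0 < eps ->
  exists n (c : nat -> R[i]), rnorm (x - \sum_(k < n) c k *: e k) < eps.
Proof.
move=> eps0; have /denseP/(_ x _ eps0)[y [n [c ->]] xy] := he.2.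
by exists n, c.
Qed.

(** A vector with zero coordinates is orthogonal to the finite combinations that
    approximate it, hence to itself. *)
Lemma coord_inj x y : (forall n, coord n x = coord n y) -> x = y.
Proof.
move=> hxy; apply/eqP; rewrite -subr_eq0; apply/eqP.
have {hxy} : forall n, coord n (x - y) = 0 by move=> n; rewrite coordB hxy subrr.
move: (x - y) => z hz; apply: rnorm_eq0; apply/eqP; rewrite eq_le rnorm_ge0 andbT.
rewrite leNgt; apply/negP => z0.
have [n [c hc]] := span_dense z z0; set s := \sum_(k < n) _ in hc.
have zs : dot z s = 0.
  rewrite /s linear_sumr big1//= => k _; rewrite dotZr.
  by rewrite -/(coord k z) hz mulr0.
have : rnorm z ^+ 2 <= rnorm z * rnorm (z - s).
  apply: le_trans (cauchy_schwarz _ _); rewrite linearBr/= zs subr0 -rnorm_dot.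
  by rewrite normc_real ler_norm.
by rewrite expr2 ler_pM2l// leNgt hc.
Qed.

Lemma rnorm_sum_basis (c : nat -> R[i]) (j n : nat) :
  rnorm (\sum_(k < n) c k *: e (k + j)%N) ^+ 2 = \sum_(k < n) normc (c k) ^+ 2.
Proof.
apply: (@complexI R); rewrite rnorm_dot rmorph_sum/= linear_sumlz/=.
apply: eq_bigr => k _; rewrite linear_sumr/= (bigD1 k)//= big1 => [|i ik].
  rewrite dotZl dotZr he.1 eqxx mulr1 addr0.
  by rewrite rmorphXn/= -norm_normc normCK.
rewrite dotZl dotZr he.1 eqn_add2r eq_sym.
by rewrite (inj_eq val_inj) (negPf ik) !mulr0.
Qed.

End OrthonormalBasis.

(** * Adjoints of weighted shifts *)

Section AdjointShift.
Context {R : realType} {V : completeNormedModType R[i]}.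
Variables (dot : {dot V for Num.conj}) (e : nat -> V).
Hypotheses (hdot : induces_norm dot) (he : orthonormal_basis dot e).
Local Notation normc := ComplexField.Normc.normc.
Local Notation coord := (coord dot e).

(** The weights are real, so that passing to the adjoint does not conjugate them. *)
Lemma adjoint_coord (w : nat -> R) (A : {linear V -> V}) (B : V -> V) :
  weighted_shift e w A -> is_adjoint dot A B ->
  forall n x, coord n (B x) = (w n)%:C * coord n.+1 x.
Proof.
move=> [_ hA] hB n x; rewrite /coord dot_conj -hB hA dotZl rmorphM/= -dot_conj.
by rewrite conj_Creal// complex_real.
Qed.

(** The estimate is Parseval's identity on finite combinations of the basis;
    continuity carries it over to the whole space. *)
Lemma weighted_shift_bound (w : nat -> R) (M : R) (A : {linear V -> V}) :
  (forall n, 0 <= w n <= M) -> weighted_shift e w A ->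
  forall x, rnorm (A x) <= M * rnorm x.
Proof.
move=> wM [cA hA] x.
have M0 : 0 <= M by have /andP[+ +] := wM 0%N; exact: le_trans.
have fin n (c : nat -> R[i]) :
    rnorm (A (\sum_(k < n) c k *: e k)) <= M * rnorm (\sum_(k < n) c k *: e k).
  rewrite -(@ler_pXn2r _ 2)// ?nnegrE ?mulr_ge0 ?rnorm_ge0// exprMn linear_sum /=.
  have -> : \sum_(k < n) c k *: e k = \sum_(k < n) c k *: e (k + 0)%N.
    by apply: eq_bigr => k _; rewrite addn0.
  have -> : \sum_(k < n) A (c k *: e k)
      = \sum_(k < n) (c k * (w k)%:C) *: e (k + 1)%N.
    by apply: eq_bigr => k _; rewrite linearZ/= hA scalerA addn1.
  rewrite (rnorm_sum_basis hdot he c) (rnorm_sum_basis hdot he (fun k => c k * (w k)%:C)).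
  rewrite mulr_sumr; apply: ler_sum => k _.
  rewrite ComplexField.Normc.normcM normc_real exprMn mulrC ler_wpM2r ?sqr_ge0//.
  have /andP[w0 w1] := wM k.
  by rewrite ger0_norm// ler_pXn2r// nnegrE.
rewrite leNgt; apply/negP => h.
pose d := (rnorm (A x) - M * rnorm x) / 2.
have d0 : 0 < d by rewrite divr_gt0// subr_gt0.
have /cA : nbhs (A x) [set y | rnorm (A x - y) < d].
  by apply/nbhs_rnormP; exists d.
move=> /nbhs_rnormP[eps eps0 xA].
have e1 : 0 < Num.min eps (d / (M + 1)) by rewrite lt_min eps0 divr_gt0// ltr_wpDl.
have [n [c]] := span_dense he x e1; set s := \sum_(k < n) _ => xs.
have /xA /= As : rnorm (x - s) < eps by rewrite (lt_le_trans xs)// ge_min lexx.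
have xs' : M * rnorm (x - s) <= d.
  rewrite (@le_trans _ _ ((M + 1) * rnorm (x - s)))//.
    by rewrite ler_wpM2r ?rnorm_ge0// lerDl.
  rewrite -ler_pdivlMl ?ltr_wpDl// mulrC ltW// (lt_le_trans xs)// ge_min lexx orbT//.
have := fin n c; rewrite -/s.
have : M * rnorm s <= M * (rnorm x + rnorm (x - s)).
  by rewrite ler_wpM2l// rnormC (le_trans _ (rnormD _ _))// addrC subrK.
have : rnorm (A x) <= rnorm (A x - A s) + rnorm (A s).
  by rewrite (le_trans _ (rnormD _ _))// subrK.
have dE : d * 2 = rnorm (A x) - M * rnorm x by rewrite /d divfK.
by rewrite mulrDr; lra.
Qed.
(** The square of the norm of B x is dot (A (B x)) x. *)
Lemma adjoint_bound (M : R) (A B : V -> V) : 0 <= M ->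
  (forall x, rnorm (A x) <= M * rnorm x) -> is_adjoint dot A B ->
  forall x, rnorm (B x) <= M * rnorm x.
Proof.
move=> M0 hA hB x; have [->|Bx0'] := eqVneq (rnorm (B x)) 0.
  by rewrite mulr_ge0// rnorm_ge0.
have Bx0 : 0 < rnorm (B x) by rewrite lt_neqAle eq_sym Bx0' rnorm_ge0.
rewrite -(ler_pM2l Bx0) -expr2.
have : (rnorm (B x) ^+ 2)%:C = dot (A (B x)) x by rewrite hB (rnorm_dot hdot).
move=> h; have := cauchy_schwarz hdot (A (B x)) x; rewrite -h normc_real.
move/(le_trans (ler_norm _))/le_trans; apply.
by rewrite mulrCA mulrA ler_wpM2r ?rnorm_ge0.
Qed.

End AdjointShift.

(** * Backward weighted shifts *)

Section BackwardShift.
Context {R : realType} {V : completeNormedModType R[i]}.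
Variables (dot : {dot V for Num.conj}) (e : nat -> V).
Hypotheses (hdot : induces_norm dot) (he : orthonormal_basis dot e).
Local Notation normc := ComplexField.Normc.normc.
Local Notation coord := (coord dot e).

Variables (w : nat -> R) (M : R) (B : {linear V -> V}).
Hypotheses (w_gt0 : forall n, 0 < w n) (w_le : forall n, w n <= M) (M_ge1 : 1 <= M).
Hypothesis B_coord : forall n x, coord n (B x) = (w n)%:C * coord n.+1 x.
Hypothesis B_le : forall x, rnorm (B x) <= M * rnorm x.

Definition wprod (n : nat) : R := \prod_(k < n) w k.
Local Notation W := wprod.

Lemma wprod_gt0 n : 0 < W n.
Proof. by apply: prodr_gt0. Qed.

Lemma wprodS n : W n.+1 = W n * w n.
Proof. by rewrite /W big_ord_recr. Qed.

Let M_gt0 : 0 < M. Proof. exact: lt_le_trans M_ge1. Qed.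

Lemma wprod_addr n k : W (n + k) <= M ^+ k * W n.
Proof.
elim: k => [|k ih]; first by rewrite addn0 mul1r.
rewrite addnS wprodS exprS -mulrA mulrC ler_pM// ltW//; exact: wprod_gt0.
Qed.

Lemma iter_coord n m x : coord m (iter n B x) * (W m)%:C = (W (m + n))%:C * coord (m + n)%N x.
Proof.
elim: n m => [|n ih] m; first by rewrite addn0 mulrC.
by rewrite iterS B_coord addnS -addSn -ih wprodS rmorphM/=; ring.
Qed.

Lemma iter_coord0 n x : coord 0 (iter n B x) = (W n)%:C * coord n x.
Proof. by have := iter_coord n 0 x; rewrite /W big_ord0 mulr1 add0n. Qed.

Lemma iterB0 n : iter n B 0 = 0.
Proof. by elim: n => //= n ->; rewrite linear0. Qed.

Lemma iterBD n x y : iter n B (x + y) = iter n B x + iter n B y.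
Proof. by elim: n => //= n ->; rewrite linearD. Qed.

Lemma iterBB n x y : iter n B (x - y) = iter n B x - iter n B y.
Proof. by elim: n => //= n ->; rewrite linearB. Qed.

Lemma iterBZ n a x : iter n B (a *: x) = a *: iter n B x.
Proof. by elim: n => //= n ->; rewrite linearZ. Qed.

Lemma iterB_sum n (I : Type) (r : seq I) (P : pred I) (F : I -> V) :
  iter n B (\sum_(i <- r | P i) F i) = \sum_(i <- r | P i) iter n B (F i).
Proof.
by elim: n => //= n ->; rewrite linear_sum.
Qed.

Lemma iterB_le n x : rnorm (iter n B x) <= M ^+ n * rnorm x.
Proof.
elim: n => [|n ih]; first by rewrite mul1r.
by rewrite iterS (le_trans (B_le _))// exprS -mulrA ler_pM2l.
Qed.

(** In this rescaled basis B becomes the unweighted shift: a vector is an infinite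
    word of which B deletes the first letter, and the products of the weights only
    enter through the norms of the letters. *)
Definition fbasis m : V := (W m)^-1%:C *: e m.

Lemma rnorm_fbasis m : rnorm (fbasis m) = (W m)^-1.
Proof.
by rewrite rnormZr (rnorm_basis hdot he) mulr1 ger0_norm// invr_ge0 ltW// wprod_gt0.
Qed.

Lemma fbasis_coord m n : coord m (fbasis n) = (W n)^-1%:C * (n == m)%:R.
Proof. by rewrite (coordZ dot e) (coord_basis he). Qed.

Lemma iter_fbasis n m : iter n B (fbasis (m + n)) = fbasis m.
Proof.
apply: (coord_inj hdot he) => j.
have Wj : (W j)%:C != 0.
  by rewrite -(rmorph0 (real_complex R)) (inj_eq (@complexI R)) gt_eqF// wprod_gt0.
apply: (mulIf Wj); rewrite iter_coord !fbasis_coord eqn_add2r.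
case: eqVneq => [->|]; last by rewrite !mulr0 mul0r.
by rewrite !mulr1 -!rmorphM/= mulVf ?mulfV// gt_eqF// wprod_gt0.
Qed.

Lemma iter_fbasis0 n m : (m < n)%N -> iter n B (fbasis m) = 0.
Proof.
move=> mn; apply: (coord_inj hdot he) => j.
have Wj : (W j)%:C != 0.
  by rewrite -(rmorph0 (real_complex R)) (inj_eq (@complexI R)) gt_eqF// wprod_gt0.
apply: (mulIf Wj); rewrite iter_coord fbasis_coord (coord0 dot e) mul0r.
by rewrite [m == _]ltn_eqF ?mulr0// (leq_trans mn)// leq_addl.
Qed.

Definition word d (c : nat -> R[i]) n : V := \sum_(k < d) c k *: fbasis (k + n).

Lemma iter_word n m d c : iter n B (word d c (m + n)) = word d c m.
Proof.
rewrite iterB_sum; apply: eq_bigr => k _.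
by rewrite iterBZ addnA iter_fbasis.
Qed.

Lemma iter_word0 n d c m : (d + m <= n)%N -> iter n B (word d c m) = 0.
Proof.
move=> dmn; rewrite iterB_sum big1// => k _; rewrite iterBZ iter_fbasis0 ?scaler0//.
by rewrite (leq_trans _ dmn)// ltn_add2r.
Qed.

Lemma rnorm_word d c n :
  rnorm (word d c n) <= \sum_(k < d) normc (c k) / W (k + n).
Proof.
apply: (le_trans (rnorm_sum _ _ _)); apply: ler_sum => k _.
by rewrite rnormZ rnorm_fbasis.
Qed.

Lemma word_small d c (eps : R) : 0 < eps -> exists2 K, 0 < K &
  forall n, (forall k, (k < d)%N -> K <= W (k + n)) -> rnorm (word d c n) < eps.
Proof.
move=> eps0; pose S := \sum_(k < d) normc (c k).
have S0 : 0 <= S by apply: sumr_ge0 => k _; exact: normc_ge0.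
have K0 : 0 < (S + 1) / eps by rewrite divr_gt0// ltr_wpDl.
exists ((S + 1) / eps) => // n hn.
apply: (le_lt_trans (rnorm_word _ _ _)).
apply: (@le_lt_trans _ _ (S / ((S + 1) / eps))).
  rewrite /S mulr_suml; apply: ler_sum => k _.
  by rewrite ler_wpM2l ?normc_ge0// lef_pV2 ?posrE ?wprod_gt0// hn.
rewrite invf_div mulrCA -[ltRHS]mulr1 ltr_pM2l// ltr_pdivrMr ?ltr_wpDl//.
by rewrite mul1r ltrDl.
Qed.

Lemma word_dense x (eps : R) : 0 < eps -> exists d c, rnorm (x - word d c 0) < eps.
Proof.
move=> /(span_dense he x)[d [c xc]]; exists d, (fun k => c k * (W k)%:C).
rewrite /word; under eq_bigr do rewrite addn0 /fbasis scalerA -mulrA -rmorphM/=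
  mulfV ?gt_eqF ?wprod_gt0// mulr1.
exact: xc.
Qed.

(** Letters in Q(i), so that the words form a countable dense set. *)
Definition rat_complex (q : rat * rat) : R[i] := (ratr q.1 : R) +i* (ratr q.2 : R).

Definition rat_word (s : seq (rat * rat)) n : V :=
  word (size s) (fun k => rat_complex (nth (0, 0) s k)) n.

Lemma rat_complex_dense (z : R[i]) (eps : R) : 0 < eps ->
  exists q, normc (z - rat_complex q) < eps.
Proof.
case: z => a b eps0.
have h (t : R) : exists q : rat, `|t - ratr q| < eps / 2.
  have [|q] := @rat_in_itvoo R (t - eps / 2) (t + eps / 2).
    by rewrite ltrD2l gt0_cp// divr_gt0.
  by rewrite in_itv/= => /andP[h1 h2]; exists q; rewrite ltr_norml; apply/andP; split; lra.
have [[q hq] [q' hq']] := (h a, h b); exists (q, q').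
have -> : (a +i* b) - rat_complex (q, q') = (a - ratr q)%:C + 'i * (b - ratr q')%:C.
  by rewrite /rat_complex; simpc.
apply: (le_lt_trans (normc_triangle _ _)).
rewrite ComplexField.Normc.normcM !normc_real /= expr0n expr1n/= add0r sqrtr1 mul1r.
by lra.
Qed.

Lemma rat_word_dense x (eps : R) : 0 < eps -> exists s, rnorm (x - rat_word s 0) < eps.
Proof.
move=> eps0; have e2 : 0 < eps / 2 by rewrite divr_gt0.
have [d [c xc]] := word_dense x e2.
have q_ex k : exists q, normc (c k - rat_complex q) < eps / 2 / d.+1%:R * W k.
  by apply: rat_complex_dense; rewrite !mulr_gt0 ?wprod_gt0// invr_gt0 ltr0n.
have [q hq] := choice q_ex; exists (mkseq q d).
apply: (le_lt_trans (rnorm_tri (word d c 0) _ _)); rewrite (splitr eps) ltrD//.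
rewrite /rat_word /word size_mkseq -sumrB.
apply: (le_lt_trans (rnorm_sum _ _ _)).
apply: (@le_lt_trans _ _ (\sum_(k < d) eps / 2 / d.+1%:R)).
  apply: ler_sum => k _; rewrite nth_mkseq// -scalerBl rnormZ rnorm_fbasis addn0.
  by rewrite ler_pdivrMr ?wprod_gt0// ltW.
rewrite sumr_const card_ord -[ltLHS]mulr_natr -mulrA gtr_pMr//.
by rewrite mulrC ltr_pdivrMr ?ltr0n// mul1r ltr_nat.
Qed.

(** * Supercyclicity, hypercyclicity and mixing *)

Lemma iterB_lip n x y : rnorm (iter n B x - iter n B y) <= M ^+ n * rnorm (x - y).
Proof. by rewrite -iterBB iterB_le. Qed.

Lemma dense_sequence :
  exists s : nat -> V, forall x eps, 0 < eps -> exists k, rnorm (x - s k) < eps.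
Proof.
exists (fun k => if unpickle k is Some q then rat_word q 0 else 0) => x eps eps0.
by have [q xq] := rat_word_dense x eps0; exists (pickle q); rewrite pickleK.
Qed.

(** A word written far out can be made small by a scalar factor, which a multiple of
    the iterate removes; the size of the products of weights does not matter. *)
Lemma supercyclic_shift : supercyclic B.
Proof.
have [s s_dense] := dense_sequence.
pose T (i : R[i] * nat) x := i.1 *: iter i.2 B x.
have [[l n]|//|x y eps eps0|x xT] := @birkhoff_universal R V _ T s.
- exists (normc l * M ^+ n) => x y; rewrite /T/= -scalerBr rnormZ -mulrA.
  by rewrite ler_wpM2l ?normc_ge0// iterB_lip.
- have e2 : 0 < eps / 2 by rewrite divr_gt0.
  have [d [c xc]] := word_dense x e2; have [d' [c' yc]] := word_dense y eps0.
  pose a : R := eps / 2 / (rnorm (word d' c' d) + 1).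
  have r0 : 0 < rnorm (word d' c' d) + 1 by rewrite ltr_wpDl// rnorm_ge0.
  have a0 : 0 < a by rewrite divr_gt0.
  exists (a^-1%:C, d), (word d c 0 + a%:C *: word d' c' d); split.
    rewrite opprD addrA; apply: le_lt_trans (rnormD _ _) _.
    rewrite (splitr eps) ltrD// rnormN rnormZr gtr0_norm// /a mulrAC.
    by rewrite ltr_pdivrMr// ltr_pM2l// ltrDl.
  rewrite /T/= iterBD iterBZ iter_word0 ?addn0// add0r (iter_word d 0) scalerA.
  by rewrite -rmorphM/= mulVf ?gt_eqF// scale1r.
- exists x; apply/denseP => y eps eps0.
  have /denseP/(_ y _ eps0)[z [[l n] ->] yz] := xT.
  by exists (l *: iter n B x) => //; exists l, n.
Qed.

(** Adding a far translate of a word steers any vector near any other one. *)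
Lemma steer x y (eps : R) : 0 < eps -> exists d K, 0 < K /\
  forall n, (d <= n)%N -> (forall k, (k < d)%N -> K <= W (k + n)) ->
  exists z, rnorm (x - z) < eps /\ rnorm (y - iter n B z) < eps.
Proof.
move=> eps0; have e2 : 0 < eps / 2 by rewrite divr_gt0.
have [d [c xc]] := word_dense x e2; have [d' [c' yc]] := word_dense y eps0.
have [K K0 hK] := word_small d' c' e2.
exists (maxn d d'), K; split => // n dn Wn; exists (word d c 0 + word d' c' n); split.
  rewrite opprD addrA; apply: le_lt_trans (rnormD _ _) _.
  rewrite (splitr eps) ltrD// rnormN hK// => k kd.
  by rewrite Wn// (leq_trans kd)// leq_maxr.
rewrite iterBD iter_word0; last by rewrite addn0 (leq_trans _ dn)// leq_maxl.
by rewrite add0r (iter_word n 0).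
Qed.

(** A product increases by at most a factor M per step, so the products shortly
    before a huge one are large as well. *)
Lemma wprod_large_run : (forall K N, exists2 n, (N <= n)%N & K <= W n) ->
  forall K N d, 0 < K -> exists2 n, (N <= n)%N & forall k, (k < d)%N -> K <= W (k + n).
Proof.
move=> hW K N d K0; have [n Ndn Wn] := hW (K * M ^+ d) (N + d)%N.
exists (n - d)%N; first by lia.
move=> k kd; have E : (k + (n - d) + (d - k) = n)%N by lia.
have := wprod_addr (k + (n - d)) (d - k); rewrite E => h.
have Md : M ^+ (d - k) <= M ^+ d by rewrite ler_weXn2l// leq_subr.
have W0 : 0 < W (k + (n - d)) by exact: wprod_gt0.
have : K * M ^+ d <= M ^+ d * W (k + (n - d)).
  by apply: (le_trans Wn); apply: (le_trans h); rewrite ler_pM2r.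
by rewrite mulrC ler_pM2l// exprn_gt0.
Qed.

Lemma hypercyclic_shift : (forall K N, exists2 n, (N <= n)%N & K <= W n) ->
  hypercyclic B.
Proof.
move=> hW; have [s s_dense] := dense_sequence.
apply: (@birkhoff_universal R V _ (fun n => iter n B) s) => //.
  by move=> n; exists (M ^+ n) => x y; exact: iterB_lip.
move=> x y eps eps0; have [d [K [K0 hK]]] := steer x y eps0.
have [n dn Wn] := wprod_large_run hW d d K0.
by have [z hz] := hK n dn Wn; exists n, z.
Qed.

(** The first coordinate of the n-th iterate of x is wprod n times the n-th
    coordinate of x, hence bounded along the orbit. *)
Lemma not_hypercyclic_shift K : (forall n, W n <= K) -> ~ hypercyclic B.
Proof.
move=> WK [x /denseP xd].
have K0 : 0 <= K by apply: le_trans (WK 0%N); rewrite ltW// wprod_gt0.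
pose t : R := K * rnorm x + 1.
have [_ [n ->]] := xd (t%:C *: e 0%N) 1 ltr01.
apply/negP; rewrite -leNgt.
apply: (le_trans _ (coord_le hdot he 0%N _)).
rewrite coordB coordZ coord_basis// eqxx mulr1.
rewrite iter_coord0.
have h : normc ((W n)%:C * coord n x) <= K * rnorm x.
  have Wn0 := wprod_gt0 n.
  rewrite ComplexField.Normc.normcM normc_real gtr0_norm//.
  by apply: ler_pM; [exact: ltW|exact: normc_ge0|exact: WK|exact: coord_le].
have : t <= normc (t%:C - (W n)%:C * coord n x) + normc ((W n)%:C * coord n x).
  apply: le_trans (normc_triangle _ _); rewrite subrK normc_real ler_norm//.
by rewrite /t; lra.
Qed.

Lemma mixing_shift : (forall K, exists N, forall n, (N <= n)%N -> K <= W n) ->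
  topologically_mixing B.
Proof.
move=> hW G1 G2 oG1 oG2 [x G1x] [y G2y].
have [e1 e10 xG1] := open_rnormP oG1 G1x; have [e2 e20 yG2] := open_rnormP oG2 G2y.
have e0 : 0 < Num.min e1 e2 by rewrite lt_min e10.
have [d [K [K0 hK]]] := steer x y e0; have [N hN] := hW K.
exists (maxn d N).+1 => // n; rewrite gtn_max => /andP[dn Nn].
have [|k _|z [xz yz]] := hK n; first exact: ltnW.
  by apply: hN; rewrite (leq_trans (ltnW Nn))// leq_addl.
exists (iter n B z); split.
  by exists z => //; apply: xG1; rewrite (lt_le_trans xz)// ge_min lexx.
by apply: yG2; rewrite (lt_le_trans yz)// ge_min lexx orbT.
Qed.

(** For large n the n-th iterate carries some vector of norm less than 1 near e 0,
    and on the first coordinate this takes a factor wprod n of at least 1 / 2. *)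
Lemma mixing_inf_gt0 : topologically_mixing B ->
  exists2 delta : R, 0 < delta & exists N, forall n, (N <= n)%N -> delta <= W n.
Proof.
move=> mixB; have h1 : 0 < (2^-1 : R) by rewrite invr_gt0.
have [||||N N0 hN] := mixB [set y | rnorm (0 - y) < 1] [set y | rnorm (e 0%N - y) < 2^-1].
- exact: open_rball.
- exact: open_rball.
- by exists 0 => /=; rewrite subrr rnorm0.
- by exists (e 0%N) => /=; rewrite subrr rnorm0.
exists 2^-1 => //; exists N => n /hN[_ [[x /= x1 <-] /= ex]].
have := coord_le hdot he 0%N (e 0%N - iter n B x).
rewrite coordB coord_basis// eqxx.
rewrite iter_coord0.
have := coord_le hdot he n x; rewrite sub0r rnormN in x1.
have : normc ((W n)%:C * coord n x) = W n * normc (coord n x).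
  by rewrite ComplexField.Normc.normcM normc_real ger0_norm// ltW// wprod_gt0.
have := normc_triangle (1 - (W n)%:C * coord n x) ((W n)%:C * coord n x).
rewrite subrK ComplexField.Normc.normc1 => h2 hE h3 h4; rewrite hE in h2.
have : W n * normc (coord n x) <= W n * 1.
  by rewrite ler_wpM2l ?(le_trans h3)// ltW// wprod_gt0.
by lra.
Qed.

(** * Li-Yorke chaos *)

(** The real multiples of one vector with an irregular orbit are an uncountable
    scrambled set. *)
Lemma li_yorke_scaled x : (forall k, exists2 n, (k <= n)%N & rnorm (iter n B x) < k.+1%:R^-1) ->
  (forall k, exists2 n, (k <= n)%N & 1 < rnorm (iter n B x)) ->
  li_yorke_chaotic B.
Proof.
move=> x_small x_large.
have x0 : x <> 0.
  by have [n _ +] := x_large 0%N; move=> /[swap] ->; rewrite iterB0 rnorm0 ltr10.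
pose f (t : R) : V := t%:C *: x.
have f_inj : injective f.
  move=> s t /eqP; rewrite -subr_eq0 -scalerBl scaler_eq0 => /orP[|/eqP//].
  by rewrite -rmorphB/= => /eqP -[/eqP]; rewrite subr_eq0 => /eqP.
exists (range f); split.
  move=> cG; have : countable [set: R].
    have /eq_countable <- : (range f #= [set: R])%card by apply: inj_card_eq; exact: in2W.
    exact: cG.
  move=> /(sub_countable (subset_card_le (@subsetT _ `[0, 1]%classic))).
  move/countable_lebesgue_measure0; rewrite lebesgue_measure_itv/= lte_fin ltr01.
  by rewrite oppr0 adde0 => -[] /eqP; rewrite oner_eq0.
move=> _ _ [s _ <-] [t _ <-] st.
have st0 : 0 < `|s - t|.
  by rewrite normr_gt0 subr_eq0; apply/eqP => E; apply: st; rewrite E.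
have E n : rnorm (iter n B (f s - f t)) = `|s - t| * rnorm (iter n B x).
  by rewrite /f -scalerBl -rmorphB/= iterBZ rnormZr.
split.
  apply: (@lt_le_trans _ _ `|s - t|%:E); first by rewrite lte_fin.
  apply: limn_esup_ge => N; have [n Nn xn] := x_large N; exists n => //.
  by rewrite lee_fin E ler_peMr// ltW.
apply/eqP; rewrite eq_le; apply/andP; split; last first.
  by apply: (@limn_einf_ge _ _ _ 0) => n _; rewrite lee_fin rnorm_ge0.
apply/lee_addgt0Pr => eps eps0; rewrite add0e.
apply: limn_einf_le => N.
have [m hm] : exists m, m.+1%:R^-1 < eps / `|s - t|.
  exists (Num.trunc (eps / `|s - t|)^-1).
  by rewrite -ltf_pV2 ?(posrE,invr_gt0,ltr0n,divr_gt0)// invrK truncnS_gt.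
have [n mn xn] := x_small (maxn N m); exists n.
  by rewrite (leq_trans _ mn)// leq_maxl.
rewrite lee_fin E mulrC -ler_pdivlMr// ltW// (lt_le_trans xn)// (le_trans _ (ltW hm))//.
by rewrite lef_pV2 ?posrE ?ltr0n// ler_nat ltnS leq_maxr.
Qed.

(** Words have orbits that reach 0, and a block of weights with a huge product turns
    a small multiple of a basis vector into a large vector; so both halves of the
    irregularity of an orbit hold on dense open sets. *)
Lemma li_yorke_shift : (forall K, exists s n, K * W s <= W (s + n)) ->
  li_yorke_chaotic B.
Proof.
move=> hW.
pose F i := let k := i./2 in if odd i
  then \bigcup_(n in [set n | (k <= n)%N]) (iter n B @^-1` [set y | rnorm (0 - y) < k.+1%:R^-1])
  else \bigcup_(n in [set n | (k <= n)%N]) (iter n B @^-1` ~` [set y | rnorm (0 - y) <= 1]).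
have [i|i|x xF] := @baire_point R V F.
- rewrite /F/=; case: odd; apply: bigcup_open => n _; apply: (lipschitz_open (@iterB_lip n)).
    exact: open_rball.
  rewrite openE => y /= /negP; rewrite -ltNge => y1; apply/nbhs_rnormP.
  exists (rnorm (0 - y) - 1); first by rewrite subr_gt0.
  move=> z yz /=; apply/negP; rewrite -ltNge.
  by have := rnorm_tri z 0 y; rewrite (rnormC z y); lra.
- rewrite /F/=; set k := i./2; case: odd; apply/denseP => x eps eps0.
    have [d [c xc]] := word_dense x eps0; exists (word d c 0) => //.
    exists (maxn k d); first by rewrite /= leq_maxl.
    by rewrite /= iter_word0 ?addn0 ?leq_maxr// subrr rnorm0 invr_gt0 ltr0n.
  have e2 : 0 < eps / 2 by rewrite divr_gt0.
  (* The factor M ^+ k forces the block to have length n >= k. *)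
  have [s [n hsn]] := hW (M ^+ k * (1 + (eps / 2)^-1 * 3)).
  have kn : (k <= n)%N.
    rewrite leqNgt; apply/negP => nk.
    have h1 : W (s + n) <= M ^+ k * W s.
      rewrite (le_trans (wprod_addr _ _))// ler_pM2r ?wprod_gt0//.
      by rewrite ler_weXn2l// ltnW.
    have := le_trans hsn h1; rewrite ler_pM2r ?wprod_gt0// ger_pMr ?exprn_gt0//.
    by rewrite gerDl leNgt mulr_gt0// invr_gt0.
  have hsn' : 3 <= eps / 2 * (W (s + n) / W s).
    rewrite -ler_pdivrMl// ler_pdivlMr ?wprod_gt0//; apply: le_trans hsn.
    rewrite ler_pM2r ?wprod_gt0//; have := exprn_ege1 k M_ge1.
    have : 0 < (eps / 2)^-1 by rewrite invr_gt0.
    move: (eps / 2)^-1 (M ^+ k) => a b a0 b1.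
    by nra.
  (* The amplified term has norm at least 3 and cannot cancel a term of norm 1. *)
  have [x1|x1] := ltP 1 (rnorm (iter n B x)).
    exists x; last by rewrite subrr rnorm0.
    by exists n => //=; apply/negP; rewrite -ltNge sub0r rnormN.
  exists (x + (eps / 2)%:C *: e (s + n)%N); last first.
    rewrite opprD addrA subrr sub0r rnormN rnormZr (rnorm_basis hdot he) mulr1.
    by rewrite gtr0_norm// ltr_pdivrMr// mulr_natr mulr2n ltrDl.
  exists n => //=; apply/negP; rewrite -ltNge sub0r rnormN.
  rewrite iterBD iterBZ.
  have -> : iter n B (e (s + n)%N) = (W (s + n) / W s)%:C *: e s.
    have -> : e (s + n)%N = (W (s + n))%:C *: fbasis (s + n).
      by rewrite scalerA -rmorphM/= mulfV ?scale1r// gt_eqF// wprod_gt0.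
    by rewrite iterBZ iter_fbasis scalerA -rmorphM.
  rewrite scalerA -rmorphM/=; set a := _ * _.
  have a3 : 3 <= a by [].
  have : rnorm (a%:C *: e s) = a.
    by rewrite rnormZr (rnorm_basis hdot he) mulr1 ger0_norm// (le_trans _ a3).
  have := rnormD (iter n B x + a%:C *: e s) (- iter n B x).
  by rewrite addrAC subrr add0r rnormN => h1 h2; lra.
apply: (@li_yorke_scaled x) => k.
  have := xF k.*2.+1; rewrite /F/= odd_double/= uphalf_double => -[n /= kn].
  by rewrite sub0r rnormN; exists n.
have := xF k.*2; rewrite /F/= odd_double/= doubleK => -[n /= kn /negP].
by rewrite sub0r rnormN -ltNge; exists n.
Qed.

Lemma not_li_yorke_contraction : (forall x, rnorm (B x) <= rnorm x) -> ~ li_yorke_chaotic B.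
Proof.
move=> B1 [G [ncG hG]].
have [x [y [Gx Gy xy]]] : exists x y, [/\ G x, G y & x <> y].
  apply: contrapT => nG; apply: ncG; have [->|/set0P[x Gx]] := eqVneq G set0.
    exact: countable0.
  apply: (@sub_countable _ _ _ [set x]); last exact: countable1.
  apply: subset_card_le => y Gy /=; apply: contrapT => yx; apply: nG.
  by exists y, x.
have [] := hG x y Gx Gy xy; set u := fun n => _ => u_sup u_inf.
have u_mono m n : (m <= n)%N -> (u n <= u m)%E.
  move=> /subnKC <-; rewrite /u lee_fin addnC iterD.
  by elim: (n - m)%N => //= k; exact: le_trans (B1 _).
have : (limn_esup u <= limn_einf u)%E; last by rewrite u_inf leNgt u_sup.
apply: (@limn_einf_ge _ _ _ 0) => n _; apply: (@limn_esup_le _ _ _ n) => m nm.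
exact: u_mono.
Qed.

Lemma sensitive_shift : (forall K, exists N, forall n, (N <= n)%N -> K <= W n) ->
  sensitive B.
Proof.
move=> hW; exists 1 => // x G /nbhs_rnormP[eps eps0 xG].
have e2 : 0 < eps / 2 by rewrite divr_gt0.
have [N hN] := hW (eps / 2)^-1.
exists (x + (eps / 2)%:C *: e N), N; split.
  apply: xG; rewrite opprD addrA subrr sub0r rnormN rnormZr (rnorm_basis hdot he) mulr1.
  by rewrite gtr0_norm// ltr_pdivrMr// mulr_natr mulr2n ltrDl.
rewrite rnormC -iterBB addrAC subrr add0r iterBZ rnormZr gtr0_norm//.
have := coord_le hdot he 0%N (iter N B (e N)); rewrite iter_coord0 coord_basis// eqxx mulr1.
rewrite normc_real gtr0_norm ?wprod_gt0// => h.
rewrite -ler_pdivrMl// mulr1; exact: le_trans (hN _ (leqnn _)) h.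
Qed.

(** * Necessary conditions for chaos and frequent hypercyclicity *)

(** For a point x of period p near e 0, wprod (j * p) times the coordinate j * p of x
    is the first coordinate of x. This bounds the products below at the multiples of
    p, and going back at most p steps costs at most a factor M ^ p. *)
Lemma chaotic_inf_gt0 : chaotic B ->
  exists2 delta : R, 0 < delta & forall n, delta <= W n.
Proof.
move=> [_ /denseP + _] => /(_ (e 0%N) 2^-1); rewrite invr_gt0 ltr0n => /(_ isT).
move=> [x [p p0 xp] ex].
have x0 : 2^-1 <= normc (coord 0 x).
  have := coord_le hdot he 0%N (e 0%N - x); rewrite coordB coord_basis// eqxx => h1.
  have := normc_triangle (1 - coord 0 x) (coord 0 x).
  by rewrite subrK ComplexField.Normc.normc1; lra.
have iter_p j : iter (j * p) B x = x.
  by elim: j => //= j ih; rewrite mulSn iterD ih xp.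
have Wp j : 2^-1 <= W (j * p) * rnorm x.
  rewrite (le_trans x0)// -{1}(iter_p j) iter_coord0 ComplexField.Normc.normcM.
  have W0 := wprod_gt0 (j * p).
  by rewrite normc_real gtr0_norm// ler_pM2l// coord_le.
have rx : 0 < rnorm x.
  have := Wp 0%N; rewrite /W mul0n big_ord0 mul1r; apply: lt_le_trans.
  by rewrite invr_gt0.
have MP : 0 < M ^+ p * rnorm x by rewrite mulr_gt0// exprn_gt0.
exists (2^-1 / (M ^+ p * rnorm x)); first by rewrite divr_gt0// invr_gt0.
move=> n; rewrite ler_pdivrMr//.
(* the multiple of p that follows n *)
pose j := (n %/ p).+1; have nj : (n <= j * p)%N by rewrite ltnW// /j -ltn_divLR.
have jp : (j * p - n <= p)%N.
  rewrite /j mulSn leq_subLR {2}(divn_eq n p) addnC leq_add2r.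
  by rewrite addnC; lia.
have := wprod_addr n (j * p - n); rewrite subnKC// => h.
apply: (le_trans (Wp j)); rewrite mulrCA mulrA ler_pM2r//.
apply: (le_trans h); rewrite mulrC [leRHS]mulrC ler_pM2l ?wprod_gt0//.
by rewrite ler_weXn2l.
Qed.

(** If two iterates b and a = b + k of x are both near e 0, then the coordinate k of
    the first is small while wprod k times it is near 1, so wprod k >= 1. The times
    at which the orbit is near e 0 have positive lower density, so their differences
    have bounded gaps, and each step back costs at most a factor M. *)
Lemma frequently_hypercyclic_inf_gt0 : frequently_hypercyclic B ->
  exists2 delta : R, 0 < delta & forall n, delta <= W n.
Proof.
move=> [x hx].
have e_ball : [set y | rnorm (e 0%N - y) < 2^-1] !=set0.
  by exists (e 0%N); rewrite /= subrr rnorm0 invr_gt0.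
have /difference_syndetic[D hD] := hx _ (open_rball _ _) e_ball; exists (M ^- D).
  by rewrite invr_gt0 exprn_gt0.
move=> n; have [a [b [r [/= ea eb rD ab]]]] := hD n.
have W1 : 1 <= W (n + r).
  have [nr0|nr0] := eqVneq (n + r)%N 0%N; first by rewrite nr0 /W big_ord0.
  have := coord_le hdot he (n + r) (e 0%N - iter b B x).
  have := coord_le hdot he 0%N (e 0%N - iter a B x).
  rewrite !coordB !(coord_basis he) eqxx [_ == (n + r)%N]eq_sym (negPf nr0) sub0r.
  move: ea; have -> : iter a B x = iter (n + r) B (iter b B x) by rewrite -iterD ab addnC.
  rewrite iter_coord0; set z := coord _ (iter b B x).
  rewrite normc_opp.
  move=> ea h1 h2.
  have := normc_triangle (1 - (W (n + r))%:C * z) ((W (n + r))%:C * z).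
  rewrite subrK ComplexField.Normc.normc1 ComplexField.Normc.normcM normc_real.
  have W0 := wprod_gt0 (n + r); rewrite gtr0_norm// => h3.
  have h4 : 2^-1 < W (n + r) * normc z by lra.
  have h5 : W (n + r) * normc z <= W (n + r) * 2^-1 by rewrite ler_pM2l//; lra.
  by lra.
rewrite -[leLHS]mul1r ler_pdivrMr ?exprn_gt0//; apply: (le_trans W1).
apply: (le_trans (wprod_addr _ _)); rewrite mulrC ler_pM2l ?wprod_gt0//.
by rewrite ler_weXn2l.
Qed.

(** * Exponential growth of the products *)

Section ExponentialGrowth.
Variables (c0 a : R).
Hypotheses (c0_gt0 : 0 < c0) (a_gt1 : 1 < a) (W_ge : forall n, c0 * a ^+ n <= W n).

Let a_gt0 : 0 < a. Proof. exact: lt_trans a_gt1. Qed.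
Let rho := a^-1.
Let rho_ge0 : 0 <= rho. Proof. by rewrite invr_ge0 ltW. Qed.
Let rho_gt0 : 0 < rho. Proof. by rewrite invr_gt0. Qed.
Let rho_lt1 : rho < 1. Proof. by rewrite invf_lt1. Qed.
Let rho1 : 0 < 1 - rho. Proof. by rewrite subr_gt0. Qed.

Lemma wprod_cvgy K : exists N, forall n, (N <= n)%N -> K <= W n.
Proof.
have [N hN] := small_geometric K rho_ge0 rho_lt1 c0_gt0.
exists N => n /hN; rewrite exprVn ltr_pdivrMr ?exprn_gt0// => h.
exact: le_trans (ltW h) (W_ge n).
Qed.

Lemma rnorm_word_growth d c n (C : R) : (forall k, (k < d)%N -> normc (c k) <= C) ->
  rnorm (word d c n) <= d%:R * C / c0 * rho ^+ n.
Proof.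
move=> hC; apply: (le_trans (rnorm_word _ _ _)).
apply: (@le_trans _ _ (\sum_(k < d) C / c0 * rho ^+ n)); last first.
  by rewrite sumr_const card_ord -[leLHS]mulr_natl !mulrA.
apply: ler_sum => k _.
have h : c0 * a ^+ n <= W (k + n).
  apply: le_trans (W_ge _); rewrite ler_pM2l//.
  by rewrite ler_weXn2l ?leq_addl// ltW.
rewrite -mulrA exprVn -invfM; apply: ler_pM; first exact: normc_ge0.
- by rewrite invr_ge0 ltW// wprod_gt0.
- exact: hC.
- by rewrite lef_pV2// posrE ?wprod_gt0// mulr_gt0// exprn_gt0.
Qed.

Lemma le_geometric_eps (b t C : R) : (forall n, t <= b + C * rho ^+ n) -> t <= b.
Proof.
move=> h; apply/ler_addgt0Pr => eps eps0.
have [N hN] := small_geometric C rho_ge0 rho_lt1 eps0.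
by rewrite (le_trans (h N))// lerD2l ltW// hN.
Qed.

(** Repeating a word with a long period k gives a point of period k near the word. *)
Lemma periodic_dense : dense (periodic_point B).
Proof.
apply/denseP => y eps eps0; have e2 : 0 < eps / 2 by rewrite divr_gt0.
have [d [c yc]] := word_dense y e2.
pose C := \sum_(k < d) normc (c k).
have hC k : (k < d)%N -> normc (c k) <= C.
  move=> kd; rewrite /C (bigD1 (Ordinal kd))//= lerDl sumr_ge0// => i _; exact: normc_ge0.
pose S := d%:R * C / c0.
have S0 : 0 <= S.
  rewrite divr_ge0 ?(ltW c0_gt0)// mulr_ge0 ?ler0n// /C sumr_ge0// => i _.
  exact: normc_ge0.
have [N hN] := small_geometric (S / (1 - rho)) rho_ge0 rho_lt1 e2.
(* k >= d separates the copies of the word; k > N makes the copies after the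
   first one small. *)
pose k := maxn d N.+1.
have k0 : (0 < k)%N by rewrite leq_max orbT.
have rk0 : 0 <= rho ^+ k by rewrite exprn_ge0.
have rk : rho ^+ k <= rho by rewrite -[leRHS]expr1 ler_wiXn2l// ltW.
have rk1 : rho ^+ k < 1 by exact: le_lt_trans rho_lt1.
pose u n := \sum_(j < n) word d c (j * k).
have [|x hx] := @geometric_limit R V u S (rho ^+ k) rk0 rk1.
  move=> n; rewrite /u big_ord_recr/= addrAC subrr add0r -exprM mulnC.
  exact: rnorm_word_growth.
exists x.
  exists k => //; apply/eqP; rewrite -subr_eq0; apply/eqP/rnorm_eq0/eqP.
  rewrite eq_le rnorm_ge0 andbT; set C' := S / (1 - rho ^+ k).
  apply: (@le_geometric_eps _ _ ((M ^+ k + 1) * C')) => n; rewrite add0r.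
  have C'0 : 0 <= C' by rewrite divr_ge0// subr_ge0 ltW.
  have uS : iter k B (u n.+1) = u n.
    rewrite /u iterB_sum big_ord_recl/= mul0n iter_word0 ?addn0 ?leq_maxl// add0r.
    by apply: eq_bigr => j _; rewrite /bump/= mulSn addnC iter_word.
  apply: (le_trans (rnorm_tri (u n) _ _)); rewrite -mulrA mulrDl mul1r lerD//.
    rewrite -uS -iterBB (le_trans (iterB_le _ _))// ler_pM2l ?exprn_gt0//.
    apply: (le_trans (hx _)); rewrite ler_wpM2l// -exprM ler_wiXn2l// ?ltW//.
    by rewrite (leq_trans _ (leq_pmull _ k0))// leqnSn.
  rewrite rnormC (le_trans (hx _))// ler_wpM2l// -exprM ler_wiXn2l ?ltW//.
  by rewrite leq_pmull.
apply: (le_lt_trans (rnorm_tri (word d c 0) _ _)); rewrite (splitr eps) ltrD//.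
have -> : word d c 0 = u 1%N by rewrite /u big_ord_recl big_ord0 addr0.
rewrite rnormC (le_lt_trans (hx _))// expr1 (le_lt_trans _ (hN k _)) ?leq_max ?leqnSn ?orbT//.
rewrite ler_wpM2r// ler_wpM2l// lef_pV2 ?posrE ?subr_gt0//.
by rewrite lerD2l lerN2.
Qed.

Lemma chaotic_shift : chaotic B.
Proof.
split; last exact: (sensitive_shift wprod_cvgy); last exact: periodic_dense.
move=> G1 G2 oG1 oG2 G1n G2n.
have [n n0 hn] := mixing_shift wprod_cvgy oG1 oG2 G1n G2n.
by exists n => //; exact: hn.
Qed.

Let sg := Num.sqrt a.
Let sg_gt1 : 1 < sg. Proof. by rewrite -sqrtr1 ltr_sqrt. Qed.
Let sg_gt0 : 0 < sg. Proof. exact: lt_trans sg_gt1. Qed.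
Let sg2 : sg ^+ 2 = a. Proof. by rewrite sqr_sqrtr// ltW. Qed.

(** The l-th entry of an enumeration in which every rational word occurs
    infinitely often, and which stays within length l + 1 and letter size sg ^ l. *)
Definition slow_word (l : nat) : seq (rat * rat) :=
  if @unpickle (seq (rat * rat) * nat)%type l is Some (s, _) then
    if (size s <= l.+1)%N && all (fun q => normc (rat_complex q) <= sg ^+ l) s
    then s else [::]
  else [::].

Lemma slow_word_size l : (size (slow_word l) <= l.+1)%N.
Proof. by rewrite /slow_word; case: unpickle => // -[s _]; case: ifP => // /andP[]. Qed.

Lemma slow_word_letter l k : (k < size (slow_word l))%N ->
  normc (rat_complex (nth (0, 0) (slow_word l) k)) <= sg ^+ l.
Proof.
rewrite /slow_word; case: unpickle => [[s _]|//]; case: ifP => // /andP[_ /allP hs] ks.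
exact: (hs _ (mem_nth (0, 0) ks)).
Qed.

Lemma slow_word_frequent s L : exists2 l, (L <= l)%N & slow_word l = s.
Proof.
pose C := \sum_(q <- s) normc (rat_complex q).
have sgV1 : sg^-1 < 1 by rewrite invf_lt1.
have sgV0 : 0 <= sg^-1 by rewrite invr_ge0 ltW.
have [N hN] := small_geometric C sgV0 sgV1 ltr01.
pose L' := maxn L (maxn (size s) N).
(* s is encoded infinitely often, once for each m, hence by arbitrarily large l *)
have [m hm] : exists m : nat, (L' <= pickle (s, m))%N.
  apply: contrapT => /forallNP h.
  have h' (m : 'I_L'.+1) : (pickle (s, nat_of_ord m) < L')%N.
    by rewrite ltnNge; apply/negP; exact: h.
  have := @leq_card _ _ (fun m => Ordinal (h' m)); rewrite !card_ord ltnn => H.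
  suff : false by [].
  by apply: H => i j [] /(pcan_inj (@pickleK _)) [] /val_inj.
have Ll : (L <= pickle (s, m))%N by rewrite (leq_trans _ hm)// leq_maxl.
exists (pickle (s, m)) => //; rewrite /slow_word pickleK.
have -> : (size s <= (pickle (s, m)).+1)%N.
  by rewrite leqW// (leq_trans _ hm)// /L' maxnCA leq_maxl.
rewrite /= ifT//; apply/allP => q qs; apply: (@le_trans _ _ C).
  rewrite /C (big_rem q qs)/= lerDl sumr_ge0// => i _; exact: normc_ge0.
have : (N <= pickle (s, m))%N by rewrite (leq_trans _ hm)// /L' !leq_max leqnn !orbT.
by move/hN; rewrite exprVn ltr_pdivrMr ?exprn_gt0// mul1r => /ltW.
Qed.

(** A word of label l has at most l + 1 letters of size sg ^ l; written l places
    further it loses a factor a ^ l = sg ^ (2 l), which beats both. *)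
Lemma slow_word_bound : exists2 K : R, 0 <= K & forall l m n, (l + m <= n)%N ->
  rnorm (rat_word (slow_word l) n) <= K * rho ^+ m.
Proof.
pose K1 := (sg - 1)^-1 + 1.
have sg10 : 0 < sg - 1 by rewrite subr_gt0.
have K10 : 0 < K1 by rewrite addr_gt0// invr_gt0.
have bern l : 1 + l%:R * (sg - 1) <= sg ^+ l.
  elim: l => [|l ih]; first by rewrite mul0r addr0.
  rewrite exprS -natr1 mulrDl mul1r.
  have l0 : 0 <= l%:R :> R by [].
  have : 0 <= l%:R * (sg - 1) ^+ 2 by rewrite mulr_ge0// sqr_ge0.
  have : sg * (1 + l%:R * (sg - 1)) <= sg * sg ^+ l by rewrite ler_pM2l.
  by nra.
have K1l l : l.+1%:R <= K1 * sg ^+ l.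
  apply: (@le_trans _ _ (K1 * (1 + l%:R * (sg - 1)))); last by rewrite ler_pM2l.
  rewrite /K1 mulrDl mul1r mulrDr mulr1 mulrCA mulVf ?gt_eqF// mulr1 -natr1.
  have h0 : 0 <= (sg - 1)^-1 by rewrite invr_ge0 ltW.
  have : 0 <= l%:R * (sg - 1) by rewrite mulr_ge0// ltW.
  by lra.
exists (K1 / c0); first by rewrite divr_ge0// ltW.
move=> l m n lmn.
have h1 := rnorm_word_growth n (@slow_word_letter l).
apply: (le_trans h1).
have h2 : (size (slow_word l))%:R <= K1 * sg ^+ l.
  by apply: le_trans (K1l l); rewrite ler_nat slow_word_size.
have rl : rho ^+ l = (sg ^+ l)^-1 / sg ^+ l.
  by rewrite /rho -sg2 exprVn -exprM mulnC exprM expr2 invfM.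
have sgl : 0 < sg ^+ l by rewrite exprn_gt0.
have h3 : rho ^+ n <= (sg ^+ l)^-1 / sg ^+ l * rho ^+ m.
  by rewrite -rl -exprD ler_wiXn2l// ltW.
apply: (@le_trans _ _ (K1 * sg ^+ l * sg ^+ l / c0 * ((sg ^+ l)^-1 / sg ^+ l * rho ^+ m))).
  apply: ler_pM => //.
  - by rewrite divr_ge0 ?(ltW c0_gt0)// mulr_ge0 ?ler0n// ltW.
  - by rewrite exprn_ge0.
  - by rewrite ler_pM2r ?invr_gt0// ler_pM2r.
rewrite le_eqVlt; apply/orP; left; apply/eqP; field.
by rewrite !gt_eqF.
Qed.

(** A sum of translated words, the j-th of which starts at start j and has label
    label j, is frequently hypercyclic: shifting by start i brings the i-th word
    to the front, kills the earlier ones, and leaves the later ones so far away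
    that they are small. *)
Lemma frequently_hypercyclic_shift : frequently_hypercyclic B.
Proof.
have [K K0 hK] := slow_word_bound.
pose y l := rat_word (slow_word l) 0.
pose z j := rat_word (slow_word (label j)) (start j).
pose u n := \sum_(j < n) z j.
pose C := K / (1 - rho).
have C0 : 0 <= C by rewrite divr_ge0// ltW.
have [|x hx] := @geometric_limit R V u K rho rho_ge0 rho_lt1.
  move=> n; rewrite /u big_ord_recr/= addrAC subrr add0r; apply: hK.
  exact: start_ge.
have z_self i : iter (start i) B (z i) = y (label i).
  by have := iter_word (start i) 0; rewrite add0n; exact.
have z_early i j : (j < i)%N -> iter (start i) B (z j) = 0.
  move=> ji; apply: iter_word0; apply: leq_trans (start_early ji).
  by rewrite leq_add2r slow_word_size.
have z_late i t : rnorm (iter (start i) B (z (i + t.+1)%N)) <= K * rho ^+ label i * rho ^+ t.+1.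
  rewrite /z -(subnK (start_mono i t.+1)) iter_word -mulrA -exprD; apply: hK.
  exact: start_late.
have u_near i n : rnorm (iter (start i) B (u (i.+1 + n)%N) - y (label i))
    <= C * rho ^+ label i * (1 - rho ^+ n).
  elim: n => [|n ih].
    rewrite addn0 subrr mulr0 /u big_ord_recr/= iterBD z_self iterB_sum big1 ?add0r.
      by rewrite subrr rnorm0.
    by move=> j _; exact: z_early.
  rewrite addnS /u big_ord_recr/= iterBD addrAC (le_trans (rnormD _ _))//.
  have h1 := z_late i n; rewrite addnS -addSn in h1.
  apply: (le_trans (lerD ih h1)).
  have -> : K = C * (1 - rho) by rewrite /C divfK// gt_eqF.
  have rl : 0 <= C * rho ^+ label i by rewrite mulr_ge0// exprn_ge0.
  have rn : 0 <= rho ^+ n by rewrite exprn_ge0.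
  rewrite !exprS -subr_ge0.
  have -> : C * rho ^+ label i * (1 - rho * rho ^+ n)
      - (C * rho ^+ label i * (1 - rho ^+ n)
         + C * (1 - rho) * rho ^+ label i * (rho * rho ^+ n))
      = C * rho ^+ label i * (rho ^+ n * (1 - rho) * (1 - rho)) by ring.
  by rewrite mulr_ge0// !mulr_ge0// ltW.
have x_near i : rnorm (iter (start i) B x - y (label i)) <= C * rho ^+ label i.
  apply: (@le_geometric_eps _ _ (M ^+ start i * C)) => n.
  apply: (le_trans (rnorm_tri (iter (start i) B (u (i.+1 + n)%N)) _ _)); rewrite addrC lerD//.
    apply: (le_trans (u_near i n)); apply: ler_piMr.
      by rewrite mulr_ge0// exprn_ge0.
    by rewrite gerBl exprn_ge0.
  rewrite -iterBB (le_trans (iterB_le _ _))// -mulrA ler_pM2l ?exprn_gt0//.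
  apply: (le_trans (hx _)); rewrite ler_wpM2l// ler_wiXn2l// ?leq_addl//; exact: ltW.
exists x => G oG [v Gv]; have [eps eps0 vG] := open_rnormP oG Gv.
have e2 : 0 < eps / 2 by rewrite divr_gt0.
have [s vs] := rat_word_dense v e2.
have [N hN] := small_geometric C rho_ge0 rho_lt1 e2.
have [l Nl ls] := slow_word_frequent s N.
pose i t := (2 ^ l * t.+1.*2.+1).-1.
apply: (@lower_density_gt0 _ _ (fun t => start (i t)) (9 * 2 ^ l)%N).
- exact: start_dyadic_inj.
- move=> t /=; apply: vG; apply: (le_lt_trans (rnorm_tri (rat_word s 0) _ _)).
  rewrite (splitr eps) ltrD// rnormC -ls.
  have := x_near (i t); rewrite /i label_dyadic => /le_lt_trans; apply.
  exact: hN.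
- exact: start_dyadic.
Qed.

End ExponentialGrowth.

End BackwardShift.

(** * Bernoulli shifts *)

(** A point z of Z stands for a sequence with first term xi z and remaining terms
    th z; the hypothesis says that the two are independent and that the law Q of the
    whole sequence is also the law of the remaining terms. *)
Section BernoulliShift.
Context {d : measure_display} {Z : measurableType d} {R : realType}.
Variables (Q : probability Z R) (xi : {mfun Z >-> R}) (th : {mfun Z >-> Z}).
Hypothesis xi_th : forall A S, measurable A -> measurable S ->
  Q (xi @^-1` A `&` th @^-1` S) = (Q (xi @^-1` A) * Q S)%E.
Local Open Scope ereal_scope.

Lemma shift_preserves S : measurable S -> Q (th @^-1` S) = Q S.
Proof.
move=> mS; have := xi_th measurableT mS.
by rewrite preimage_setT setTI probability_setT mul1e.
Qed.

Lemma integral_shift (g : Z -> \bar R) : measurable_fun setT g -> (forall z, 0 <= g z) ->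
  \int[Q]_z g (th z) = \int[Q]_z g z.
Proof.
move=> mg g0; rewrite -(@ge0_integral_distribution _ _ Z Z R Q th g)//.
by apply: eq_measure_integral => S mS _; exact: shift_preserves.
Qed.

(** The joint law of xi and th is a product measure: Tonelli's theorem. *)
Lemma integral_indep (f : R -> \bar R) (g : Z -> \bar R) :
  measurable_fun setT f -> measurable_fun setT g ->
  (forall x, 0 <= f x) -> (forall z, 0 <= g z) ->
  \int[Q]_z (f (xi z) * g (th z)) = (\int[Q]_z f (xi z)) * \int[Q]_z g z.
Proof.
move=> mf mg f0 g0.
pose pr z : R * Z := (xi z, th z).
have mpr : measurable_fun setT pr by exact: measurable_fun_pair.
pose pr_mixin := isMeasurableFun.Build _ _ _ _ _ mpr.
pose pr' : {mfun Z >-> (R * Z)%type} := HB.pack pr pr_mixin.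
pose h (p : R * Z) := f p.1 * g p.2.
have mh : measurable_fun setT h.
  by apply: emeasurable_funM; exact: measurableT_comp.
have h0 p : 0 <= h p by rewrite mule_ge0.
have -> : \int[Q]_z (f (xi z) * g (th z)) = \int[distribution Q pr']_p h p.
  by rewrite ge0_integral_distribution.
rewrite -(@ge0_integral_distribution _ _ Z R R Q xi f)//.
have -> : \int[distribution Q pr']_p h p = \int[distribution Q xi \x Q]_p h p.
  apply: eq_measure_integral => S mS _; apply/esym.
  apply: (@product_measure_unique _ _ _ _ _ (distribution Q xi) Q (distribution Q pr')) => //.
rewrite (@fubini_tonelli1 _ _ _ _ _ (distribution Q xi) Q h mh h0) /fubini_F.
under eq_integral => x _ do rewrite /h/= ge0_integralZl//.
by rewrite ge0_integralZr// integral_ge0.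
Qed.

Lemma integral_shift_invariant D (g : Z -> \bar R) : measurable D -> th @^-1` D = D ->
  measurable_fun setT g -> (forall z, 0 <= g z) ->
  \int[Q]_(z in D) g (th z) = \int[Q]_(z in D) g z.
Proof.
move=> mD thD mg g0; rewrite [LHS]integral_mkcond [RHS]integral_mkcond.
rewrite -[RHS]integral_shift; last 2 first.
- by apply/(measurable_restrictT _ mD); exact: measurable_funTS.
- by move=> z; rewrite /patch; case: ifP.
apply: eq_integral => z _; rewrite /patch -{1}thD.
by congr (if _ then _ else _); apply/idP/idP; rewrite !inE.
Qed.

(** An invariant set is determined by th, hence independent of xi. *)
Lemma integral_indep_invariant D (f : R -> \bar R) : measurable D -> th @^-1` D = D ->
  measurable_fun setT f -> (forall x, 0 <= f x) ->
  \int[Q]_(z in D) f (xi z) = (\int[Q]_z f (xi z)) * Q D.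
Proof.
move=> mD thD mf f0; have mD1 : measurable_fun setT (fun z => (\1_D z : R)%:E).
  by apply/measurable_EFinP; exact: measurable_indic.
have := integral_indep mf mD1 f0; rewrite integral_indic// setIT => <-; last first.
  by move=> z; rewrite lee_fin.
rewrite integral_mkcond; apply: eq_integral => z _.
rewrite /patch indicE -{1}thD.
have -> : (z \in th @^-1` D) = (th z \in D) by apply/idP/idP; rewrite !inE.
by case: ifP; rewrite ?mule1 ?mule0.
Qed.

(** * Maxima of partial sums *)

Definition psum (f : R -> R) n z : R := (\sum_(k < n) f (xi (iter k th z)))%R.

(** The maximum of the first partial sums, the empty one included. The recursion on
    the first term is what makes stationarity applicable. *)
Fixpoint smax (f : R -> R) n z : R :=
  if n is n'.+1 then Num.max 0%R (f (xi z) + smax f n' (th z))%R else 0%R.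

Lemma psumS f n z : psum f n.+1 z = (f (xi z) + psum f n (th z))%R.
Proof.
rewrite /psum big_ord_recl/=; congr (_ + _)%R; apply: eq_bigr => k _.
by rewrite -iterSr.
Qed.

Lemma smax_ge0 f n z : (0 <= smax f n z)%R.
Proof. by case: n => //= n; rewrite le_max lexx. Qed.

Lemma psum_le_smax f n z : (psum f n z <= smax f n z)%R.
Proof.
elim: n z => [|n ih] z; first by rewrite /psum big_ord0.
by rewrite psumS/= le_max lerD2l ih orbT.
Qed.

Lemma smax_attained f n z : exists k, smax f n z = psum f k z.
Proof.
elim: n z => [|n ih] z; first by exists 0%N; rewrite /psum big_ord0.
have [k hk] := ih (th z); rewrite /= maxEle; case: ifP => _.
  by exists k.+1; rewrite psumS hk.
by exists 0%N; rewrite /psum big_ord0.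
Qed.

Lemma smax_mono f m n z : (m <= n)%N -> (smax f m z <= smax f n z)%R.
Proof.
elim: m n z => [|m ih] n z; first by move=> _; exact: smax_ge0.
case: n => // n mn /=; rewrite ge_max le_max lexx/= le_max.
by rewrite lerD2l ih// orbT.
Qed.

Lemma measurable_smax f n : measurable_fun setT f -> measurable_fun setT (smax f n).
Proof.
move=> mf; elim: n => [|n ih]; first exact: measurable_cst.
apply: measurable_maxr; first exact: measurable_cst.
apply: measurable_funD; first exact: measurableT_comp.
exact: measurableT_comp ih _.
Qed.

Definition sup_infinite f : set Z := \bigcap_K \bigcup_n [set z | (K%:R < smax f n z)%R].

Lemma measurable_sup_infinite f : measurable_fun setT f -> measurable (sup_infinite f).
Proof.
move=> mf; apply: bigcap_measurable => // K _; apply: bigcup_measurable => n _.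
rewrite -[X in measurable X]setTI.
by apply: measurable_fun_ltr => //; exact: measurable_smax.
Qed.

Lemma shift_sup_infinite f : th @^-1` (sup_infinite f) = sup_infinite f.
Proof.
apply/seteqP; split=> z /= hz K _.
  have [n _ hn] := hz (Num.trunc (K%:R - f (xi z))).+1 I.
  exists n.+1 => //=; rewrite lt_max; apply/orP; right.
  rewrite /= in hn; have := truncnS_gt (K%:R - f (xi z))%R; lra.
have [[|n] _ hn] := hz (Num.trunc (K%:R + `|f (xi z)|)).+1 I.
  by move: hn; rewrite /= ltNge ler0n.
exists n => //=; have h0 := truncnS_gt (K%:R + `|f (xi z)|)%R.
move: hn; rewrite /= lt_max => /orP[h|h].
  by have := ler0n R (Num.trunc (K%:R + `|f (xi z)|)).+1; rewrite leNgt h.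
by have := ler_norm (f (xi z)); lra.
Qed.

Lemma sup_infiniteP f z : sup_infinite f z <-> forall K : R, exists n, (K < psum f n z)%R.
Proof.
split=> h K.
  have [n _ /= hn] := h (Num.trunc K).+1 I; have [k hk] := smax_attained f n z.
  by exists k; rewrite -hk (lt_trans _ hn)// truncnS_gt.
by move=> _; have [n hn] := h K%:R; exists n => //=; exact: lt_le_trans (psum_le_smax _ _ _).
Qed.

Lemma not_sup_infiniteP f z : ~ sup_infinite f z -> exists C : R, forall n, (smax f n z <= C)%R.
Proof.
move=> /existsNP[K /not_implyP[_ h]]; exists K%:R => n.
by rewrite leNgt; apply/negP => hn; apply: h; exists n.
Qed.

(** The summand is p - m with p and m nonnegative: all the integrals below are then
    integrals of nonnegative functions. *)
Section Drift.
Variables p m : R -> R.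
Hypotheses (mp : measurable_fun setT p) (mm : measurable_fun setT m).
Hypotheses (p0 : forall x, (0 <= p x)%R) (m0 : forall x, (0 <= m x)%R).
Let Ep := \int[Q]_z (p (xi z))%:E.
Let Em := \int[Q]_z (m (xi z))%:E.
Hypotheses (Ep_fin : Ep < +oo) (Em_fin : Em < +oo).
Let f x := (p x - m x)%R.

Let mf : measurable_fun setT f. Proof. exact: measurable_funB. Qed.

Let smax_le_sum n z : (smax f n.+1 z <= p (xi z) + smax f n (th z))%R.
Proof.
have := m0 (xi z); have := p0 (xi z); have := smax_ge0 f n (th z).
by rewrite /= ge_max /f; move=> *; apply/andP; split; lra.
Qed.

Let mE (g : Z -> R) : measurable_fun setT g -> measurable_fun setT (EFin \o g).
Proof. by move=> mg; exact/measurable_EFinP. Qed.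

Let mpxi : measurable_fun setT (fun z => p (xi z)).
Proof. exact: measurableT_comp. Qed.

Let mmxi : measurable_fun setT (fun z => m (xi z)).
Proof. exact: measurableT_comp. Qed.

Let msmaxth n : measurable_fun setT (fun z => smax f n (th z)).
Proof. by apply: measurableT_comp; [exact: measurable_smax|exact: measurable_funPT]. Qed.

Lemma smax_integrable n : \int[Q]_z (smax f n z)%:E < +oo.
Proof.
elim: n => [|n ih]; first by rewrite integral0_eq.
apply: (@le_lt_trans _ _ (\int[Q]_z ((p (xi z))%:E + (smax f n (th z))%:E))).
  apply: ge0_le_integral => //.
  - by move=> z _; rewrite lee_fin smax_ge0.
  - by apply: mE; exact: measurable_smax.
  - by apply: emeasurable_funD; exact: mE.
  - by move=> z _; rewrite -EFinD lee_fin.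
rewrite ge0_integralD//; last first.
- exact: mE.
- by move=> z _; rewrite lee_fin smax_ge0.
- exact: mE.
- by move=> z _; rewrite lee_fin.
rewrite (integral_shift (g := fun z => (smax f n z)%:E)).
- by rewrite lte_add_pinfty.
- by apply: mE; exact: measurable_smax.
- by move=> z; rewrite lee_fin smax_ge0.
Qed.

(** Let D be the invariant event that the sums are unbounded. The recursion
    smax_(n+1) = max (0, f + smax_n o th) and stationarity give
    E [max (f, - smax_n o th); D] >= 0. On D the integrand decreases to f as n grows,
    so that E [f; D] = Q D * E f >= 0, and Q D = 0 if E f < 0. In the proof m is added
    to the integrand to make it nonnegative. *)
Lemma sup_finite_of_neg_drift : Ep < Em -> Q (sup_infinite f) = 0.
Proof.
move=> EpEm; set D := sup_infinite f.
have mD : measurable D by exact: measurable_sup_infinite.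
have thD : th @^-1` D = D by exact: shift_sup_infinite.
pose k n z : R := (Num.max (f (xi z)) (- smax f n (th z)) + m (xi z))%R.
have k0 n z : (0 <= k n z)%R.
  rewrite /k; have : (f (xi z) <= Num.max (f (xi z)) (- smax f n (th z)))%R by rewrite le_max lexx.
  by move: (Num.max _ _) => t; rewrite {1}/f; have := p0 (xi z); lra.
have mk n : measurable_fun setT (k n).
  apply: measurable_funD => //; apply: measurable_maxr; first exact: measurableT_comp.
  exact: measurableT_comp.
have kE n z : (k n z + smax f n (th z) = smax f n.+1 z + m (xi z))%R.
  by rewrite /k /= !maxEle; do 2 case: ifP => [|/negbT]; rewrite -?ltNge; lra.
have ms n : measurable_fun setT (fun z => (smax f n z)%:E).
  by apply: mE; exact: measurable_smax.
have s0 n z : 0 <= (smax f n z)%:E by rewrite lee_fin smax_ge0.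
have sfin n : \int[Q]_(z in D) (smax f n z)%:E \is a fin_num.
  rewrite ge0_fin_numE; last exact: integral_ge0.
  by apply: le_lt_trans (smax_integrable n); apply: ge0_subset_integral.
have step n : \int[Q]_(z in D) (m (xi z))%:E <= \int[Q]_(z in D) (k n z)%:E.
  have : \int[Q]_(z in D) ((k n z)%:E + (smax f n (th z))%:E)
      = \int[Q]_(z in D) ((smax f n.+1 z)%:E + (m (xi z))%:E).
    by apply: eq_integral => z _; rewrite -!EFinD kE.
  rewrite !ge0_integralD//; try by [move=> z _; rewrite lee_fin ?smax_ge0 |
    apply: measurable_funTS; exact: mE | apply: measurable_funTS; exact: ms].
  rewrite (integral_shift_invariant (g := fun z => (smax f n z)%:E))// => E.
  rewrite -(leeD2rE _ _ (sfin n)) E addeC; apply: leeD2l.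
  apply: ge0_le_integral => //; try exact: measurable_funTS.
  by move=> z _; rewrite lee_fin smax_mono.
have lim : \int[Q]_(z in D) (k n z)%:E @[n --> \oo] --> \int[Q]_(z in D) (p (xi z))%:E.
  apply: (@dominated_cvg _ _ _ _ _ mD _ _ (fun z => (p (xi z))%:E + (m (xi z))%:E)).
  - by move=> n; apply: measurable_funTS; exact: mE.
  - move=> z Dz; apply: cvg_near_cst.
    have [n hn] : exists n, (- f (xi z) < smax f n (th z))%R.
      have /sup_infiniteP/(_ (- f (xi z))%R)[n hn] : D (th z).
        by have : (th @^-1` D) z by rewrite thD.
      by exists n; exact: lt_le_trans (psum_le_smax _ _ _).
    exists n => // n' /= nn'; congr EFin; rewrite /k.
    have h := smax_mono f (th z) nn'.
    rewrite max_l; first by rewrite /f subrK.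
    by lra.
  - by [].
  - apply: integrableD => //; apply/integrableP; split.
    + by apply: measurable_funTS; exact: mE.
    + rewrite (eq_integral (fun z => (p (xi z))%:E)); last first.
        by move=> z _; rewrite gee0_abs ?lee_fin.
      apply: le_lt_trans Ep_fin; apply: ge0_subset_integral => //.
        exact: mE.
      by move=> z _; rewrite lee_fin.
    + by apply: measurable_funTS; exact: mE.
    + rewrite (eq_integral (fun z => (m (xi z))%:E)); last first.
        by move=> z _; rewrite gee0_abs ?lee_fin.
      apply: le_lt_trans Em_fin; apply: ge0_subset_integral => //.
        exact: mE.
      by move=> z _; rewrite lee_fin.
  - move=> n z _; rewrite /= ger0_norm// lee_fin.
    rewrite /k lerD2r ge_max; have := m0 (xi z); have := p0 (xi z).
    have := smax_ge0 f n (th z); rewrite /f => *; apply/andP; split; lra.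
have : \int[Q]_(z in D) (m (xi z))%:E <= \int[Q]_(z in D) (p (xi z))%:E.
  rewrite -(cvg_lim _ lim)//; apply: lime_ge; first by apply/cvg_ex; eexists; exact: lim.
  by apply: nearW => n; exact: step.
rewrite !(integral_indep_invariant mD thD (f := fun x => (_ x)%:E))//; last 2 first.
- exact/measurable_EFinP.
- exact/measurable_EFinP.
have [->//|QD] := eqVneq (Q D) 0.
have QD0 : 0 < Q D by rewrite lt0e QD measure_ge0.
have Qfin : Q D \is a fin_num by exact: fin_num_measure.
by rewrite lee_pmul2r// leNgt EpEm.
Qed.

Lemma ae_eq_of_integral_le D (u v : Z -> R) : measurable D ->
  measurable_fun setT u -> measurable_fun setT v ->
  (forall z, D z -> (0 <= v z)%R) -> (forall z, D z -> (v z <= u z)%R) ->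
  \int[Q]_(z in D) (v z)%:E < +oo ->
  \int[Q]_(z in D) (u z)%:E <= \int[Q]_(z in D) (v z)%:E ->
  {ae Q, forall z, D z -> u z = v z}.
Proof.
move=> mD mu mv v0 vu v_fin uv.
have muv : measurable_fun setT (fun z => u z - v z)%R by exact: measurable_funB.
have E : \int[Q]_(z in D) (u z)%:E =
    \int[Q]_(z in D) (u z - v z)%:E + \int[Q]_(z in D) (v z)%:E.
  rewrite -ge0_integralD//.
  - by apply: eq_integral => z _; rewrite -EFinD subrK.
  - by move=> z Dz; rewrite lee_fin subr_ge0 vu.
  - by apply: measurable_funTS; exact: mE.
  - by apply: measurable_funTS; exact: mE.
have vfin : \int[Q]_(z in D) (v z)%:E \is a fin_num.
  by rewrite ge0_fin_numE// integral_ge0.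
have I0 : \int[Q]_(z in D) `|(u z - v z)%:E| = 0.
  apply/eqP; rewrite eq_le; apply/andP; split; last exact: integral_ge0.
  rewrite (eq_integral (fun z => (u z - v z)%:E)); last first.
    by move=> z /set_mem Dz; rewrite gee0_abs// lee_fin subr_ge0 vu.
  by move: uv; rewrite E -[leRHS]add0e leeD2rE.
have /(ae_eq_integral_abs Q mD) [/(_ I0) + _] :
  measurable_fun D (fun z => (u z - v z)%:E) by apply: measurable_funTS; exact: mE.
apply: filterS => z h Dz; apply/eqP; rewrite -subr_eq0.
by have := h Dz => /= -[/eqP].
Qed.

(** With zero drift suppose the sums stay bounded on an event F of positive
    probability, and let M be their supremum there, so that M >= f + M o th on F.
    Truncating M and using Fatou's lemma, E [M - M o th; F] <= 0 = E [f; F], whence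
    M = f + M o th almost surely on F. As f (xi _) and M o th are independent,
    E exp (- M) = E exp (- f) * E exp (- M) on F, so E exp (- f) = 1 = E (1 - f),
    and f vanishes by strict convexity. *)
Lemma sup_infinite_of_zero_drift : Ep = Em ->
  ~ {ae Q, forall z, p (xi z) = m (xi z)} -> Q (~` sup_infinite f) = 0.
Proof.
move=> EpEm f_ne0; set F := ~` sup_infinite f.
have mF : measurable F by apply: measurableC; exact: measurable_sup_infinite.
have thF : th @^-1` F = F by rewrite /F -[in RHS]shift_sup_infinite.
have F_th z : F z -> F (th z) by move=> Fz; have : (th @^-1` F) z by rewrite thF.
pose M : Z -> R := (fun z => sup (range (fun n => smax f n z))) \_ F.
have M_ub z : F z -> has_ubound (range (fun n => smax f n z)).
  by move=> /not_sup_infiniteP[C hC]; exists C => _ [n _ <-].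
have ME z : F z -> M z = sup (range (fun n => smax f n z)).
  by move=> Fz; rewrite /M patchE mem_set.
have M0 z : (0 <= M z)%R.
  have [Fz|nFz] := pselect (F z); last by rewrite /M patchE memNset.
  by rewrite ME//; apply: (ub_le_sup (M_ub _ Fz)); exists 0%N.
have mM : measurable_fun setT M.
  apply/(measurable_restrictT _ mF).
  apply: (@measurable_fun_cvg _ _ _ _ (fun n => smax f n)).
    by move=> n; apply: measurable_funTS; exact: measurable_smax.
  move=> z Fz; apply: nondecreasing_cvgn; last exact: M_ub.
  by move=> n k nk; exact: smax_mono.
have mMth : measurable_fun setT (fun z => M (th z)) by exact: measurableT_comp.
have Mrec z : F z -> (f (xi z) + M (th z) <= M z)%R.
  move=> Fz; rewrite -lerBrDl (ME _ (F_th _ Fz)); apply: ge_sup.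
    by exists (smax f 0 (th z)); exists 0%N.
  move=> _ [n _ <-]; rewrite lerBrDl ME//.
  apply: (@le_trans _ _ (smax f n.+1 z)); first by rewrite /= le_max lexx orbT.
  by apply: (ub_le_sup (M_ub _ Fz)); exists n.+1.
pose k (K : nat) z : R := (Num.min (M z) K%:R - Num.min (M (th z)) K%:R + m (xi z))%R.
have k0 K z : F z -> (0 <= k K z)%R.
  move=> /Mrec; rewrite /k; have := p0 (xi z); have := m0 (xi z); rewrite /f.
  by rewrite !minEle; do 2 case: ifP => [|/negbT]; rewrite -?ltNge; lra.
have mminM K : measurable_fun setT (fun z => Num.min (M z) K%:R).
  by apply: measurable_minr.
have mminMth K : measurable_fun setT (fun z => Num.min (M (th z)) K%:R).
  by apply: measurable_minr.
have mk K : measurable_fun setT (k K).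
  by apply: measurable_funD => //; apply: measurable_funB.
have min0 K z : (0 <= Num.min (M z) K%:R)%R by rewrite le_min M0 ler0n.
have TSE (g : Z -> R) : measurable_fun setT g -> measurable_fun F (fun z => (g z)%:E).
  by move=> mg; apply: measurable_funTS; exact: mE.
have int_k K : \int[Q]_(z in F) (k K z)%:E = \int[Q]_(z in F) (m (xi z))%:E.
  have : \int[Q]_(z in F) ((k K z)%:E + (Num.min (M (th z)) K%:R)%:E)
      = \int[Q]_(z in F) ((m (xi z))%:E + (Num.min (M z) K%:R)%:E).
    by apply: eq_integral => z _; rewrite -!EFinD /k; congr EFin; ring.
  rewrite !ge0_integralD//; try by [move=> z Fz; rewrite lee_fin ?min0 ?k0 | exact: TSE].
  rewrite (integral_shift_invariant (g := fun z => (Num.min (M z) K%:R)%:E))//; last 2 first.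
  - by apply: mE; exact: mminM.
  - by move=> z; rewrite lee_fin.
  set c := \int[Q]_(z in F) (Num.min (M z) K%:R)%:E => E.
  suff cfin : c \is a fin_num by rewrite -[LHS](addeK _ cfin) E addeK.
  rewrite ge0_fin_numE; last by apply: integral_ge0 => z _; rewrite lee_fin.
  apply: (@le_lt_trans _ _ (\int[Q]_(z in F) K%:R%:E)).
    apply: ge0_le_integral => //; try by [exact: TSE | move=> z _; rewrite lee_fin].
    by move=> z _; rewrite lee_fin ge_min lexx orbT.
  by rewrite integral_cst// lte_mul_pinfty// ?lee_fin// -ge0_fin_numE// fin_num_measure.
have intF_m : \int[Q]_(z in F) (m (xi z))%:E = Em * Q F.
  apply: (integral_indep_invariant mF thF (f := fun x => (m x)%:E)) => //.
  exact/measurable_EFinP.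
have intF_p : \int[Q]_(z in F) (p (xi z))%:E = Ep * Q F.
  apply: (integral_indep_invariant mF thF (f := fun x => (p x)%:E)) => //.
  exact/measurable_EFinP.
have [//|QF] := eqVneq (Q F) 0; exfalso; apply: f_ne0.
have QF0 : 0 < Q F by rewrite lt0e QF measure_ge0.
have QFfin : Q F \is a fin_num by exact: fin_num_measure.
have Ep0 : 0 <= Ep by apply: integral_ge0 => z _; rewrite lee_fin.
have Ep_fn : Ep \is a fin_num by rewrite ge0_fin_numE.
have coboundary : {ae Q, forall z, F z -> (M z - M (th z) + m (xi z) = p (xi z))%R}.
  apply: ae_eq_of_integral_le => //.
  - by apply: measurable_funD => //; exact: measurable_funB.
  - by move=> z /Mrec; rewrite /f; lra.
  - by rewrite intF_p lte_mul_pinfty// -ge0_fin_numE.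
  rewrite intF_p EpEm -intF_m.
  have := @fatou _ _ _ Q F mF (fun K z => (k K z)%:E) (fun K => TSE _ (mk K)).
  rewrite (eq_integral (fun z => (M z - M (th z) + m (xi z))%:E)); last first.
    move=> z _; apply: (cvg_limn_einf_sup _).1; apply: cvg_near_cst.
    exists (Num.trunc (Num.max (M z) (M (th z)))).+1 => // K /= hK.
    have : (Num.max (M z) (M (th z)) < K%:R)%R.
      by apply: (lt_le_trans (truncnS_gt _)); rewrite ler_nat.
    rewrite gt_max => /andP[h1 h2]; rewrite /k !min_l//; exact: ltW.
  move=> /(_ (fun K z Fz => k0 K z Fz)) /le_trans; apply.
  under eq_fun do rewrite int_k.
  by rewrite (cvg_limn_einf_sup (cvg_cst _)).1.
pose g z : R := (\1_F z * expR (- M z))%R.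
have mg : measurable_fun setT g.
  apply: measurable_funM; first exact: measurable_indic.
  by apply: measurableT_comp => //; exact: measurable_funN.
have g0 z : (0 <= g z)%R by rewrite mulr_ge0 ?expR_ge0.
have th_F z : \1_F (th z) = \1_F z :> R.
  rewrite !indicE -{2}thF.
  by have -> : (z \in th @^-1` F) = (th z \in F) by apply/idP/idP; rewrite !inE.
have mef : measurable_fun setT (fun x => expR (- f x)).
  by apply: measurableT_comp => //; exact: measurable_funN.
have mefxi : measurable_fun setT (fun z => expR (- f (xi z))).
  by apply: (measurableT_comp mef); exact: measurable_funPT.
have mgth : measurable_fun setT (fun z => g (th z)).
  by apply: (measurableT_comp mg); exact: measurable_funPT.
have g_fix : \int[Q]_z (g z)%:E = (\int[Q]_z (expR (- f (xi z)))%:E) * \int[Q]_z (g z)%:E.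
  rewrite -(integral_indep (f := fun x => (expR (- f x))%:E)
    (g := fun z => (g z)%:E)); last 4 first.
  - exact/measurable_EFinP.
  - exact: mE.
  - by move=> x; rewrite lee_fin expR_ge0.
  - by move=> z; rewrite lee_fin.
  apply: ae_eq_integral => //.
  - exact: mE.
  - by apply: emeasurable_funM; apply: mE.
  apply: filterS coboundary => z h _; rewrite -EFinM /g th_F; congr EFin.
  rewrite indicE; case: (boolP (z \in F)) => [/set_mem/h|_]; last by rewrite !mul0r mulr0.
  rewrite !mul1r -expRD /f => E; congr expR; lra.
have g_pos : 0 < \int[Q]_z (g z)%:E.
  rewrite lt0e integral_ge0 ?andbT//; last by move=> z _; rewrite lee_fin.
  apply/eqP => Ig.
  have : \int[Q]_z `|(g z)%:E| = 0.
    by rewrite -[RHS]Ig; apply: eq_integral => z _; rewrite gee0_abs// lee_fin.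
  move/(ae_eq_integral_abs Q measurableT (mE mg)) => [N [mN N0 hN]].
  move: QF; rewrite -measure_le0; apply/negP/negPn; rewrite -N0 le_measure ?inE//.
  move=> z Fz; apply: hN => /(_ I) /= [] /eqP.
  by rewrite /g indicE mem_set// mul1r gt_eqF// expR_gt0.
have int1 : \int[Q]_z (1 : \bar R) = 1 by rewrite integral_cst// mul1e; exact: probability_setT.
have g_fin : \int[Q]_z (g z)%:E < +oo.
  apply: (@le_lt_trans _ _ (\int[Q]_z 1)); last first.
    by rewrite int1 ltry.
  apply: ge0_le_integral => //; try by [exact: mE | move=> z _; rewrite lee_fin].
  move=> z _; rewrite lee_fin /g indicE; case: (_ \in _); rewrite ?mul0r// mul1r.
  by rewrite -expR0 ler_expR oppr_le0.
have ef1 : \int[Q]_z (expR (- f (xi z)))%:E = 1.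
  have gfn : \int[Q]_z (g z)%:E \is a fin_num by rewrite ge0_fin_numE// ltW.
  move: g_fix g_pos; rewrite -(fineK gfn); move: (fine _) => v /esym.
  case: (\int[Q]_z _) => [e||].
  - rewrite -EFinM => -[/eqP]; rewrite -subr_eq0 -[X in (_ - X)%R]mul1r -mulrBl mulf_eq0 subr_eq0.
    by move=> /orP[/eqP ->//|/eqP ->]; rewrite ltxx.
  - by move=> + v0; rewrite gt0_mulye.
  - by move=> + v0; rewrite gt0_mulNye.
suff : {ae Q, forall z, setT z -> (expR (- f (xi z)) + p (xi z) = 1 + m (xi z))%R}.
  apply: filterS => z /(_ I) E; apply/eqP; apply/negPn/negP => h.
  have := @expR_gt1Dx _ (- f (xi z))%R; rewrite oppr_eq0 subr_eq0 => /(_ h).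
  by rewrite /f in E *; lra.
apply: ae_eq_of_integral_le => //.
- exact: measurable_funD.
- exact: measurable_funD.
- by move=> z _; rewrite addr_ge0.
- by move=> z _; have := expR_ge1Dx (- f (xi z)); rewrite /f; lra.
- under eq_integral do rewrite EFinD.
  rewrite ge0_integralD//; [|by move=> z _; rewrite lee_fin|exact: mE].
  by rewrite int1 lte_add_pinfty// ltry.
change (\int[Q]_z ((expR (- f (xi z)))%:E + (p (xi z))%:E)
  <= \int[Q]_z (1 + (m (xi z))%:E)).
rewrite !ge0_integralD//; try by [exact: mE | move=> z _; rewrite lee_fin ?expR_ge0].
rewrite ef1 int1.
by rewrite -/Ep -/Em EpEm.
Qed.

End Drift.

(** * Runs *)

Fixpoint run (A : set R) L : set Z :=
  if L is L'.+1 then xi @^-1` A `&` th @^-1` (run A L') else setT.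

Lemma runP A L z : run A L z <-> forall k, (k < L)%N -> A (xi (iter k th z)).
Proof.
elim: L z => [|L ih] z; first by split.
split=> /= [[Az /ih h] [|k] //|h]; first by rewrite ltnS => /h; rewrite iterSr.
by split; [exact: (h 0%N)|apply/ih => k kL; have := h k.+1 kL; rewrite iterSr].
Qed.

Lemma measurable_preim d' (T : measurableType d') (g : Z -> T) B :
  measurable_fun setT g -> measurable B -> measurable (g @^-1` B).
Proof. by move=> mg mB; rewrite -[X in measurable X]setTI; exact: mg. Qed.

Lemma measurable_iter n : measurable_fun setT (iter n th).
Proof.
elim: n => [|n ih]; first exact: measurable_id.
by rewrite [iter _ _](_ : _ = th \o iter n th)//; exact: measurableT_comp.
Qed.

Lemma measurable_run A L : measurable A -> measurable (run A L).
Proof.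
move=> mA; elim: L => [|L ih]; first exact: measurableT.
by apply: measurableI; apply: measurable_preim.
Qed.

Lemma iter_preserves n S : measurable S -> Q (iter n th @^-1` S) = Q S.
Proof.
move=> mS; elim: n => [|n ih]; first by [].
have -> : iter n.+1 th @^-1` S = th @^-1` (iter n th @^-1` S).
  by apply/seteqP; split=> z /=; rewrite -iterSr.
rewrite shift_preserves ?ih//; apply: measurable_preim => //; exact: measurable_iter.
Qed.

Lemma run_indep A L S : measurable A -> measurable S ->
  Q (run A L `&` iter L th @^-1` S) = Q (xi @^-1` A) ^+ L * Q S.
Proof.
move=> mA mS; elim: L => [|L ih]; first by rewrite setTI expe0 mul1e.
have -> : run A L.+1 `&` iter L.+1 th @^-1` S
    = xi @^-1` A `&` th @^-1` (run A L `&` iter L th @^-1` S).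
  by apply/seteqP; split=> z /=; rewrite -iterSr; tauto.
rewrite xi_th// ?ih ?expeS ?muleA//; apply: measurableI; first exact: measurable_run.
by apply: measurable_preim => //; exact: measurable_iter.
Qed.

(** The event that no run occurs is contained in its translate by L. It misses the
    part of that translate where a run occurs at time 0, which by independence is a
    positive fraction of it. *)
Lemma no_run_null A L : measurable A -> 0 < Q (xi @^-1` A) ->
  Q (\bigcap_s (iter s th @^-1` ~` run A L)) = 0.
Proof.
move=> mA A0; set F := \bigcap_s _.
have mF : measurable F.
  apply: bigcap_measurable => // s _; apply: measurable_preim; first exact: measurable_iter.
  by apply: measurableC; exact: measurable_run.
have mFL : measurable (iter L th @^-1` F) by apply: measurable_preim => //; exact: measurable_iter.
have mrF : measurable (run A L `&` iter L th @^-1` F).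
  by apply: measurableI => //; exact: measurable_run.
have disj : F `&` (run A L `&` iter L th @^-1` F) = set0.
  by apply/seteqP; split => // z /= [h [r _]]; exact: (h 0%N I) r.
have : Q (F `|` (run A L `&` iter L th @^-1` F)) <= Q (iter L th @^-1` F).
  apply: le_measure; rewrite ?inE//; first exact: measurableU.
  move=> z [Fz|[_]//] s _ /=; rewrite -iterD; exact: (Fz (s + L)%N).
have QU : Q (F `|` (run A L `&` iter L th @^-1` F))
    = Q F + Q (run A L `&` iter L th @^-1` F) by rewrite measureU.
rewrite QU run_indep// iter_preserves// -[leRHS]adde0 leeD2lE//; last first.
  exact: fin_num_measure.
apply: contraTeq => F0; rewrite -ltNge mule_gt0//; first by rewrite expe_gt0.
by rewrite lt0e F0 measure_ge0.
Qed.

End BernoulliShift.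

(** * The sequence space *)

Section SequenceSpace.
Context {R : realType}.

Definition cylinder : set (set (nat -> R)) :=
  [set S | exists n (B : nat -> set R), (forall j, measurable (B j)) /\
    S = [set y | forall j, (j < n)%N -> B j (y j)]].

Definition seqspace := g_sigma_algebraType cylinder.
HB.instance Definition _ := Measurable.on seqspace.

Lemma measurable_cylinder n (B : nat -> set R) : (forall j, measurable (B j)) ->
  measurable ([set y | forall j, (j < n)%N -> B j (y j)] : set seqspace).
Proof. by move=> mB; apply: sub_sigma_algebra; exists n, B. Qed.

Definition head_coord (y : seqspace) : R := y 0%N.
Definition seqshift (y : seqspace) : seqspace := fun n => y n.+1.

Lemma iter_seqshift k (y : seqspace) n : iter k seqshift y n = y (n + k)%N.
Proof. by elim: k n => [|k ih] n; rewrite ?addn0// iterS /seqshift ih addSnnS. Qed.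

Lemma measurable_to_seqspace d (T : measurableType d) (g : T -> seqspace) :
  (forall n (B : nat -> set R), (forall j, measurable (B j)) ->
    measurable [set t | forall j, (j < n)%N -> B j (g t j)]) ->
  measurable_fun setT g.
Proof.
move=> h; apply: (@measurability _ _ T seqspace setT g cylinder) => //.
by move=> _ [_ [n [B [mB ->]]] <-]; rewrite setTI; exact: h.
Qed.

Lemma measurable_head_coord : measurable_fun setT head_coord.
Proof.
move=> _ B mB; rewrite setTI.
have -> : head_coord @^-1` B = [set y | forall j, (j < 1)%N -> B (y j)].
  by apply/seteqP; split=> y /= h; [case|exact: h].
exact: (@measurable_cylinder 1 (fun=> B)).
Qed.
HB.instance Definition _ := isMeasurableFun.Build _ _ seqspace R head_coord measurable_head_coord.

Lemma measurable_seqshift : measurable_fun setT seqshift.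
Proof.
apply: measurable_to_seqspace => n B mB.
have -> : [set y : seqspace | forall j, (j < n)%N -> B j (seqshift y j)]
    = [set y | forall j, (j < n.+1)%N -> (if j is j'.+1 then B j' else setT) (y j)].
  by apply/seteqP; split=> y /= h; [case=> //= j; exact: h|move=> j; exact: (h j.+1)].
apply: (@measurable_cylinder n.+1 (fun j => if j is j'.+1 then B j' else setT)).
by case.
Qed.
HB.instance Definition _ :=
  isMeasurableFun.Build _ _ seqspace seqspace seqshift measurable_seqshift.

End SequenceSpace.

(** * Sums and runs of independent sequences *)

Section IndependentSequence.
Context {d : measure_display} {Omega : measurableType d} {R : realType}.
Variables (P : probability Omega R) (X : nat -> {RV P >-> R}).
Hypotheses (X_id : identically_distributed X) (X_indep : mutually_independent X).

Definition trajectory (w : Omega) : @seqspace R := fun n => X n w.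

Lemma measurable_trajectory : measurable_fun setT trajectory.
Proof.
apply: measurable_to_seqspace => n B mB.
have -> : [set w | forall j, (j < n)%N -> B j (trajectory w j)]
    = \bigcap_(j in [set j | (j < n)%N]) (X j @^-1` B j) by [].
apply: bigcap_measurableType => j _.
by rewrite -[X in measurable X]setTI; exact: measurable_funPT.
Qed.
HB.instance Definition _ :=
  isMeasurableFun.Build _ _ Omega seqspace trajectory measurable_trajectory.

Let Q := distribution P trajectory.

Lemma cylinder_prob n (B : nat -> set R) : (forall j, measurable (B j)) ->
  Q [set y | forall j, (j < n)%N -> B j (y j)] = (\prod_(j < n) P (X 0 @^-1` B j))%E.
Proof.
move=> mB; rewrite /Q /distribution /pushforward; have := X_indep (iota_uniq 0 n) mB.
have -> : [set w | forall j, j \in iota 0 n -> B j (X j w)]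
    = trajectory @^-1` [set y | forall j, (j < n)%N -> B j (y j)].
  by apply/seteqP; split=> w /= h j jn; apply: h; move: jn; rewrite mem_iota add0n.
rewrite -[X in iota _ X]subn0 -/(index_iota 0 n) big_mkord => ->.
by apply: eq_bigr => j _; exact: X_id.
Qed.

(** Both sides are finite measures in S, and independence makes them agree on the
    cylinders, which generate the sigma-algebra and are stable under intersection. *)
Lemma trajectory_bernoulli A S : measurable A -> measurable S ->
  Q (head_coord @^-1` A `&` seqshift @^-1` S) = (Q (head_coord @^-1` A) * Q S)%E.
Proof.
move=> mA mS.
have mcA : measurable (head_coord @^-1` A : set (@seqspace R)).
  by rewrite -[X in measurable X]setTI; exact: measurable_head_coord.
have QA : Q (head_coord @^-1` A) = P (X 0 @^-1` A) by [].
have cfin : Q (head_coord @^-1` A) \is a fin_num by exact: fin_num_measure.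
have c0 : 0 <= fine (Q (head_coord @^-1` A)) by rewrite fine_ge0.
pose c := NngNum c0.
rewrite -(fineK cfin) setIC.
apply: (@g_sigma_algebra_measure_unique _ R seqspace cylinder _ (fun=> setT) _ _
  (pushforward (mrestr Q mcA) seqshift) (mscale c Q)) => //.
- by move=> _ [n [B [mB ->]]]; exact: measurable_cylinder.
- by move=> _; exists 0%N, (fun=> setT); split => //; apply/seteqP; split.
- by apply/seteqP; split => // y _; exists 0%N.
- move=> _ _ [n [B [mB ->]]] [n' [B' [mB' ->]]].
  exists (maxn n n'), (fun j => (if (j < n)%N then B j else setT)
                          `&` (if (j < n')%N then B' j else setT)); split.
    by move=> j; apply: measurableI; case: ifP.
  apply/seteqP; split=> y /=.
    by move=> [h h'] j _; split; case: ifP => //; [exact: h|exact: h'].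
  by move=> h; split=> j jn; have [] := h j _; rewrite ?leq_max ?jn ?orbT.
- move=> _ [n [B [mB ->]]]; set S' := [set y | _].
  transitivity (P (X 0 @^-1` A) * Q S')%E; last by rewrite /mscale -QA -(fineK cfin).
  have mB' j : measurable (if j is j'.+1 then B j' else A) by case: j.
  have := @cylinder_prob n.+1 (fun j => if j is j'.+1 then B j' else A) mB'.
  rewrite big_ord_recl/= -(cylinder_prob n mB) => <-.
  change (Q (seqshift @^-1` S' `&` head_coord @^-1` A) = Q [set y | forall j, (j < n.+1)%N ->
    (if j is j'.+1 then B j' else A) (y j)]); congr (Q _).
  apply/seteqP; split=> y /=; first by move=> [h Ay] [|j]//; exact: h.
  by move=> h; split; [move=> j jn; exact: (h j.+1)|exact: (h 0%N)].
- move=> _; change (Q (seqshift @^-1` setT `&` head_coord @^-1` A) < +oo)%E.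
  by rewrite preimage_setT setTI -ge0_fin_numE.
Qed.

Lemma ae_trajectory (N : set (@seqspace R)) (G : Omega -> Prop) : measurable N -> Q N = 0%E ->
  (forall w, ~ N (trajectory w) -> G w) -> {ae P, forall w, G w}.
Proof.
move=> mN QN0 NG; exists (trajectory @^-1` N); split => //.
  by rewrite -[X in measurable X]setTI; exact: measurable_trajectory.
by move=> w /= nG; apply: contrapT => /NG.
Qed.

Lemma psum_trajectory (g : R -> R) n w :
  psum head_coord seqshift g n (trajectory w) = \sum_(k < n) g (X k w).
Proof.
by apply: eq_bigr => k _; congr (g _); exact: (iter_seqshift k (trajectory w) 0).
Qed.

Section Sums.
Variables p m : R -> R.
Hypotheses (mp : measurable_fun setT p) (mm : measurable_fun setT m).
Hypotheses (p0 : forall x, 0 <= p x) (m0 : forall x, 0 <= m x).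
Let Ep := (\int[P]_w (p (X 0 w))%:E)%E.
Let Em := (\int[P]_w (m (X 0 w))%:E)%E.

Let mpm : measurable_fun setT (fun x => p x - m x).
Proof. exact: measurable_funB. Qed.

Let integral_head_coord (g : R -> R) : measurable_fun setT g -> (forall x, 0 <= g x) ->
  (\int[Q]_y (g (head_coord y))%:E = \int[P]_w (g (X 0 w))%:E)%E.
Proof.
move=> mg g0; rewrite (@ge0_integral_distribution _ _ Omega seqspace R P trajectory
  (fun y => (g (head_coord y))%:E))//.
- by apply/measurable_EFinP; apply: measurableT_comp => //; exact: measurable_head_coord.
- by move=> y; rewrite lee_fin.
Qed.

Lemma sums_bounded_above : (Em < +oo)%E -> (Ep < Em)%E ->
  {ae P, forall w, exists C, forall n, \sum_(k < n) (p (X k w) - m (X k w)) <= C}.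
Proof.
move=> Em_fin EpEm.
apply: (ae_trajectory (measurable_sup_infinite head_coord seqshift mpm)).
  apply: (sup_finite_of_neg_drift trajectory_bernoulli) => //.
  - by rewrite integral_head_coord//; exact: lt_trans EpEm Em_fin.
  - by rewrite integral_head_coord.
  - by rewrite !integral_head_coord.
move=> w /not_sup_infiniteP[C hC]; exists C => n.
rewrite -(psum_trajectory (fun x => p x - m x)).
exact: le_trans (psum_le_smax _ _ _ _ _) (hC n).
Qed.

Lemma sums_unbounded_above : (Ep < +oo)%E -> Ep = Em ->
  ~ {ae P, forall w, p (X 0 w) = m (X 0 w)} ->
  {ae P, forall w, forall C, exists n, C < \sum_(k < n) (p (X k w) - m (X k w))}.
Proof.
move=> Ep_fin EpEm pm.
apply: (ae_trajectory (N := ~` sup_infinite head_coord seqshift (fun x => p x - m x))).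
- by apply: measurableC; exact: measurable_sup_infinite.
- apply: (sup_infinite_of_zero_drift trajectory_bernoulli) => //.
  + by rewrite integral_head_coord.
  + by rewrite integral_head_coord// -/Em -EpEm.
  + by rewrite !integral_head_coord.
  + move=> [N [mN N0 hN]]; apply: pm; exists (trajectory @^-1` N); split => //.
      by rewrite -[X in measurable X]setTI; exact: measurable_trajectory.
    by move=> w /= h; apply: hN.
move=> w /contrapT/sup_infiniteP h C; have [n hn] := h C; exists n.
by rewrite -(psum_trajectory (fun x => p x - m x)).
Qed.

End Sums.

Lemma long_runs A : measurable A -> (0 < P (X 0 @^-1` A))%E ->
  {ae P, forall w, forall L, exists s, forall k, (k < L)%N -> A (X (k + s) w)}.
Proof.
move=> mA A0; apply/ae_foralln => L.
apply: (ae_trajectory _ (no_run_null trajectory_bernoulli L mA _)) => //.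
  apply: bigcap_measurable => // s _; apply: measurable_preim; first exact: measurable_iter.
  by apply: measurableC; exact: measurable_run.
move=> w /existsNP[s /not_implyP[_ /contrapT]] /runP h; exists s => k kL.
have := h k kL; rewrite -iterD.
have E : head_coord (iter (k + s) seqshift (trajectory w)) = X (k + s) w.
  exact: (iter_seqshift (k + s) (trajectory w) 0).
by rewrite -E.
Qed.

End IndependentSequence.

(** * Products of random weights *)

Section WeightSequences.
Context {R : realType}.
Variable X : nat -> R.
Hypothesis X_gt0 : forall n, 0 < X n.

Definition lnpos (x : R) : R := Num.max (ln x) 0.
Definition lnneg (x : R) : R := Num.max (- ln x) 0.

Lemma lnposB x : lnpos x - lnneg x = ln x.
Proof. by rewrite /lnpos /lnneg !maxEle; do 2 case: ifP => [|/negbT]; rewrite -?ltNge; lra. Qed.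

Lemma wprod_expR n : wprod X n = expR (\sum_(k < n) ln (X k)).
Proof. by rewrite /wprod expR_sum; apply: eq_bigr => k _; rewrite lnK ?posrE. Qed.

(** The finitely many sums up to N are bounded, so an unbounded sequence of sums is
    also unbounded beyond N. *)
Lemma wprod_frequently_large :
  (forall C, exists n, C < \sum_(k < n) ln (X k)) ->
  forall K N, exists2 n, (N <= n)%N & K <= wprod X n.
Proof.
move=> h K N.
pose C := \sum_(k < N) `|\sum_(j < k) ln (X j)| + `|ln K|.
have [n hn] := h C; exists n.
  rewrite leqNgt; apply/negP => nN; move: hn; apply/negP; rewrite -leNgt.
  apply: (le_trans (ler_norm _)); rewrite /C (bigD1 (Ordinal nN))//= -addrA lerDl.
  by rewrite addr_ge0// sumr_ge0.
rewrite wprod_expR; have [K0|K0] := leP K 0; first exact: le_trans K0 (expR_ge0 _).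
rewrite -[leLHS]lnK ?posrE// ler_expR ltW//; apply: le_lt_trans hn.
rewrite (le_trans (ler_norm _))// /C lerDr sumr_ge0//.
Qed.

Lemma wprod_not_bounded_below :
  (forall C, exists n, \sum_(k < n) ln (X k) < - C) ->
  ~ exists2 delta : R, 0 < delta & exists N, forall n, (N <= n)%N -> delta <= wprod X n.
Proof.
move=> h [delta delta0 [N hN]].
pose C := \sum_(k < N) `|\sum_(j < k) ln (X j)| + `|ln delta|.
have [n hn] := h C; have [nN|Nn] := ltnP n N.
  move: hn; apply/negP; rewrite -leNgt lerNl.
  apply: (le_trans (ler_norm _)); rewrite normrN /C (bigD1 (Ordinal nN))//= -addrA lerDl.
  by rewrite addr_ge0// sumr_ge0.
have := hN n Nn; rewrite wprod_expR -[leLHS]lnK ?posrE// ler_expR leNgt => /negP; apply.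
apply: (lt_le_trans hn); rewrite lerNl.
by rewrite (le_trans (ler_norm _))// normrN /C lerDr sumr_ge0.
Qed.

End WeightSequences.

Section RandomWeights.
Context {d : measure_display} {Omega : measurableType d} {R : realType}.
Variables (P : probability Omega R) (X : nat -> {RV P >-> R}).
Hypotheses (X_id : identically_distributed X) (X_indep : mutually_independent X).
Hypothesis X_ge0 : forall n, {ae P, forall w, 0 <= X n w}.
Variable M : R.
Hypotheses (M_ge1 : 1 <= M) (X_le : forall n, {ae P, forall w, X n w <= M}).
Hypothesis X_neq0 : P [set w | X 0 w = 0] = 0%E.
Hypothesis X_nondeg : nondegenerate_rv (X 0).

Lemma weights_gt0 : {ae P, forall w, forall n, 0 < X n w}.
Proof.
apply/ae_foralln => n; have Xn0 : {ae P, forall w, X n w <> 0}.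
  exists (X n @^-1` [set 0]); split; last by move=> w /= /contrapT.
    by rewrite -[X in measurable X]setTI; exact: measurable_funPT.
  by have := X_id n (measurable_set1 0); rewrite /distribution /pushforward => ->.
apply: filterS2 (X_ge0 n) Xn0 => w h1 h2.
by rewrite lt_neqAle h1 andbT eq_sym; exact/eqP.
Qed.

Local Open Scope ereal_scope.

Let Elnpos := \int[P]_w (lnpos (X 0 w))%:E.
Let Elnneg := \int[P]_w (lnneg (X 0 w))%:E.

Lemma lnpos_ge0 (x : R) : (0 <= lnpos x)%R.
Proof. by rewrite /lnpos le_max lexx orbT. Qed.

Lemma lnneg_ge0 (x : R) : (0 <= lnneg x)%R.
Proof. by rewrite /lnneg le_max lexx orbT. Qed.

Lemma measurable_lnpos : measurable_fun setT (@lnpos R).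
Proof. by apply: measurable_maxr; [exact: measurable_ln|exact: measurable_cst]. Qed.

Lemma measurable_lnneg : measurable_fun setT (@lnneg R).
Proof.
apply: measurable_maxr; last exact: measurable_cst.
by apply: measurable_funN; exact: measurable_ln.
Qed.

Lemma measurable_comp_weight (g : R -> R) : measurable_fun setT g ->
  measurable_fun setT (fun w => (g (X 0 w))%:E).
Proof. by move=> mg; apply/measurable_EFinP; exact: measurableT_comp. Qed.

Lemma Elnpos_fin : Elnpos < +oo.
Proof.
apply: (@le_lt_trans _ _ (\int[P]_w (ln M)%:E)).
  apply: ae_ge0_le_integral => //.
  - by move=> w _; rewrite lee_fin lnpos_ge0.
  - exact: measurable_comp_weight measurable_lnpos.
  - by move=> w _; rewrite lee_fin ln_ge0.
  apply: filterS2 weights_gt0 (X_le 0%N) => w /(_ 0%N) w0 wM _.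
  rewrite lee_fin /lnpos ge_max ln_ge0// andbT ler_ln//.
  by rewrite posrE (lt_le_trans _ M_ge1).
by rewrite integral_cst// lte_mul_pinfty ?lee_fin ?ln_ge0// -ge0_fin_numE// fin_num_measure.
Qed.

Lemma expectation_ln : 'E_P[fun w => ln (X 0 w)] = Elnpos - Elnneg.
Proof.
rewrite unlock integralE; congr (_ - _); apply: eq_integral => w _.
  by rewrite funeposE -EFin_max.
by rewrite funenegE -EFinN -EFin_max.
Qed.

(** Otherwise X 0 would be almost surely 1, and its essential range a point. *)
Lemma weights_not_one : ~ {ae P, forall w, lnpos (X 0 w) = lnneg (X 0 w)}.
Proof.
move=> h; have {h} [N [mN N0 hN]] : {ae P, forall w, X 0 w = 1%R}.
  apply: filterS2 weights_gt0 h => w /(_ 0%N) w0 h.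
  have : ln (X 0 w) = 0%R by rewrite -lnposB h subrr.
  by rewrite -ln1 => /ln_inj -> //; rewrite posrE.
have ess1 x : essran (X 0) x -> x = 1%R.
  move=> hx; apply/eqP/negPn/negP => x1.
  have : 0 < P (X 0 @^-1` ~` [set 1%R]).
    apply: (hx (~` [set 1%R])); last exact/eqP.
    exact/closed_openC/accessible_closed_set1/hausdorff_accessible/norm_hausdorff.
  have PN : P (X 0 @^-1` ~` [set 1%R]) <= P N.
    apply: le_measure; rewrite ?inE//.
    rewrite -[X in measurable X]setTI; apply: measurable_funPT => //.
    by apply: measurableC; exact: measurable_set1.
  by rewrite ltNge -N0 PN.
by have [x [y [/ess1 -> /ess1 ->]]] := X_nondeg.
Qed.

(** The sums of eps - ln (X k) have negative drift when eps is half the mean, so they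
    stay bounded above. *)
Lemma weights_growth : Elnneg < Elnpos ->
  {ae P, forall w, exists c a : R, [/\ (0 < c)%R, (1 < a)%R &
    forall n, (c * a ^+ n <= wprod (fun n => X n w) n)%R]}.
Proof.
move=> neg_pos.
have pos_fn : Elnpos \is a fin_num.
  rewrite ge0_fin_numE ?Elnpos_fin// integral_ge0// => w _.
  by rewrite lee_fin lnpos_ge0.
have neg_fn : Elnneg \is a fin_num.
  rewrite ge0_fin_numE ?(lt_trans neg_pos Elnpos_fin)// integral_ge0// => w _.
  by rewrite lee_fin lnneg_ge0.
pose eps := ((fine Elnpos - fine Elnneg) / 2)%R.
have pn : (fine Elnneg < fine Elnpos)%R by rewrite -lte_fin !fineK.
have eps0 : (0 < eps)%R by rewrite divr_gt0// subr_gt0.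
have mp : measurable_fun setT (fun x : R => lnneg x + eps)%R.
  by apply: measurable_funD => //; exact: measurable_lnneg.
have p0 x : (0 <= lnneg x + eps)%R by rewrite addr_ge0 ?lnneg_ge0// ltW.
have Ep : \int[P]_w (lnneg (X 0 w) + eps)%:E = Elnneg + eps%:E.
  under eq_integral do rewrite EFinD.
  rewrite ge0_integralD//.
  - rewrite integral_cst//; congr (_ + _); rewrite -[RHS]mule1; congr (_ * _).
    exact: probability_setT.
  - by move=> w _; rewrite lee_fin lnneg_ge0.
  - exact: measurable_comp_weight measurable_lnneg.
  - by move=> w _; rewrite lee_fin ltW.
have := sums_bounded_above X_id X_indep mp measurable_lnpos p0 lnpos_ge0 Elnpos_fin.
rewrite Ep => /(_ _) H; have {}H := H _.
have /H{H} : Elnneg + eps%:E < Elnpos.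
  by rewrite -(fineK pos_fn) -(fineK neg_fn) -EFinD lte_fin /eps; lra.
apply: filterS2 weights_gt0 => w w0 [C hC]; exists (expR (- C)), (expR eps); split.
- exact: expR_gt0.
- by rewrite expR_gt1.
move=> n; rewrite wprod_expR// -expRM_natl -expRD ler_expR.
have := hC n.
have -> : (\sum_(k < n) (lnneg (X k w) + eps - lnpos (X k w)) =
   n%:R * eps - \sum_(k < n) ln (X k w))%R.
  rewrite -[(n%:R * eps)%R](_ : \sum_(k < n) eps = _)%R; last first.
    by rewrite sumr_const card_ord mulr_natl.
  by rewrite -sumrB; apply: eq_bigr => k _; rewrite -lnposB; ring.
by lra.
Qed.

(** The mean may be minus infinity. By Fatou's lemma it is still negative after the
    negative part of the logarithm is truncated at some K, and then there is room for
    adding a small eps to each term. *)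
Lemma weights_decay : Elnpos < Elnneg ->
  {ae P, forall w, exists C eps : R, (0 < eps)%R /\
    forall n, (\sum_(k < n) ln (X k w) <= C - n%:R * eps)%R}.
Proof.
move=> pos_neg.
have pos_fn : Elnpos \is a fin_num.
  rewrite ge0_fin_numE ?Elnpos_fin// integral_ge0// => w _.
  by rewrite lee_fin lnpos_ge0.
pose m (K : nat) x : R := Num.min (lnneg x) K%:R.
have mm K : measurable_fun setT (m K).
  by apply: measurable_minr; [exact: measurable_lnneg|exact: measurable_cst].
have m0 K x : (0 <= m K x)%R by rewrite le_min lnneg_ge0 ler0n.
have m_fin K : \int[P]_w (m K (X 0 w))%:E < +oo.
  apply: (@le_lt_trans _ _ (\int[P]_w K%:R%:E)).
    apply: ge0_le_integral => //; try by [exact: measurable_comp_weight|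
      move=> w _; rewrite lee_fin].
    by move=> w _; rewrite lee_fin ge_min lexx orbT.
  by rewrite integral_cst// lte_mul_pinfty ?lee_fin// -ge0_fin_numE// fin_num_measure.
have [K hK] : exists K, Elnpos < \int[P]_w (m K (X 0 w))%:E.
  apply: contrapT => /forallNP h.
  have : Elnneg <= Elnpos.
    have := @fatou _ _ _ P setT measurableT (fun K w => (m K (X 0 w))%:E)
      (fun K => measurable_comp_weight (mm K)).
    rewrite (eq_integral (fun w => (lnneg (X 0 w))%:E)); last first.
      move=> w _; apply: (cvg_limn_einf_sup _).1; apply: cvg_near_cst.
      exists (Num.trunc (lnneg (X 0 w))).+1 => // K /= hK; rewrite /m min_l//.
      by rewrite ltW// (lt_le_trans (truncnS_gt _))// ler_nat.
    move=> /(_ (fun K w _ => m0 K _)) /le_trans; apply.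
    by apply: limn_einf_le => K; exists K => //; rewrite leNgt; apply/negP; exact: h.
  by rewrite leNgt pos_neg.
have m_fn : \int[P]_w (m K (X 0 w))%:E \is a fin_num.
  by rewrite ge0_fin_numE// integral_ge0// => w _; rewrite lee_fin.
pose eps := ((fine (\int[P]_w (m K (X 0 w))%:E) - fine Elnpos) / 2)%R.
have pn : (fine Elnpos < fine (\int[P]_w (m K (X 0 w))%:E))%R by rewrite -lte_fin !fineK.
have eps0 : (0 < eps)%R by rewrite divr_gt0// subr_gt0.
have mp : measurable_fun setT (fun x : R => lnpos x + eps)%R.
  by apply: measurable_funD => //; exact: measurable_lnpos.
have p0 x : (0 <= lnpos x + eps)%R by rewrite addr_ge0 ?lnpos_ge0// ltW.
have Ep : \int[P]_w (lnpos (X 0 w) + eps)%:E = Elnpos + eps%:E.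
  under eq_integral do rewrite EFinD.
  rewrite ge0_integralD//.
  - rewrite integral_cst//; congr (_ + _); rewrite -[RHS]mule1; congr (_ * _).
    exact: probability_setT.
  - by move=> w _; rewrite lee_fin lnpos_ge0.
  - exact: measurable_comp_weight measurable_lnpos.
  - by move=> w _; rewrite lee_fin ltW.
have H : Elnpos + eps%:E < \int[P]_w (m K (X 0 w))%:E.
  by rewrite -(fineK pos_fn) -(fineK m_fn) -EFinD lte_fin /eps; lra.
rewrite -Ep in H.
have := sums_bounded_above X_id X_indep mp (mm K) p0 (m0 K) (m_fin K) H.
apply: filterS => w [C hC]; exists C, eps; split => // n.
have := hC n; apply: contra_leT; rewrite -!ltNge => h.
have : (\sum_(k < n) (ln (X k w) + eps) <= \sum_(k < n) (lnpos (X k w) + eps - m K (X k w)))%R.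
  apply: ler_sum => k _; rewrite -lnposB /m.
  have : (Num.min (lnneg (X k w)) K%:R <= lnneg (X k w))%R by rewrite ge_min lexx.
  by lra.
by rewrite big_split/= sumr_const card_ord -[X in (_ + X)%R]mulr_natl; lra.
Qed.

(** The zero drift theorem applies to ln (X k) and to its opposite. *)
Lemma weights_oscillate : Elnpos = Elnneg ->
  {ae P, forall w, forall C : R, exists n, (C < \sum_(k < n) ln (X k w))%R} /\
  {ae P, forall w, forall C : R, exists n, (\sum_(k < n) ln (X k w) < - C)%R}.
Proof.
move=> E; split.
  have := sums_unbounded_above X_id X_indep measurable_lnpos measurable_lnneg
    lnpos_ge0 lnneg_ge0 Elnpos_fin E weights_not_one.
  apply: filterS => w h C; have [n hn] := h C; exists n.
  by under eq_bigr do rewrite -lnposB.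
have neg_fin : Elnneg < +oo by rewrite -E Elnpos_fin.
have := sums_unbounded_above X_id X_indep measurable_lnneg measurable_lnpos
    lnneg_ge0 lnpos_ge0 neg_fin (esym E) _.
move=> /(_ _) H; have {}H := H _.
have /H : ~ {ae P, forall w, lnneg (X 0 w) = lnpos (X 0 w)}.
  by move=> h; apply: weights_not_one; apply: filterS h => w.
apply: filterS => w h C; have [n hn] := h C; exists n.
rewrite ltrNr -sumrN; apply: (lt_le_trans hn); apply: ler_sum => k _.
by rewrite -lnposB; lra.
Qed.

(** Some c > 1 is exceeded with positive probability, so runs of L weights larger
    than c occur, with products at least c ^ L. *)
Lemma weights_long_blocks (r : R) : essran (X 0) r -> (1 < r)%R ->
  {ae P, forall w, forall K : R, exists s n,
    (K * wprod (fun n => X n w) s <= wprod (fun n => X n w) (s + n))%R}.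
Proof.
move=> hr r1; pose c := ((1 + r) / 2)%R.
have c1 : (1 < c)%R by rewrite /c; lra.
have cr : (c < r)%R by rewrite /c; lra.
have cpos : 0 < P (X 0 @^-1` [set x | (c < x)%R]).
  by apply: (hr [set x | (c < x)%R]); [exact: open_gt|exact: cr].
have mc : measurable [set x : R | (c < x)%R].
  by apply: open_measurable; exact: open_gt.
have := long_runs X_id X_indep mc cpos.
apply: filterS2 weights_gt0 => w w0 h K.
have c0 : (0 < c)%R by rewrite (lt_trans _ c1).
have ci0 : (0 <= c^-1)%R by rewrite invr_ge0 ltW.
have ci1 : (c^-1 < 1)%R by rewrite invf_lt1.
have [L hL] := small_geometric K ci0 ci1 ltr01.
have [s hs] := h L; exists s, L.
have KL : (K <= c ^+ L)%R.
  by have := hL L (leqnn _); rewrite exprVn ltr_pdivrMr ?exprn_gt0// mul1r => /ltW.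
have W0 := wprod_gt0 w0 s.
apply: (@le_trans _ _ (c ^+ L * wprod (fun n => X n w) s))%R; first by rewrite ler_pM2r.
rewrite mulrC; elim: L {hL KL} hs => [|L ih] hs; first by rewrite mulr1 addn0.
rewrite exprSr mulrA addnS wprodS; apply: ler_pM.
- by rewrite ltW// mulr_gt0// exprn_gt0.
- exact: ltW.
- by apply: ih => k kL; apply: hs; rewrite ltnS ltnW.
- by have := hs L (ltnSn L); rewrite addnC => /ltW.
Qed.

(** The complement of the support of a law on the line is covered by countably
    many null intervals with rational endpoints. *)
Lemma weights_le_essran (r : R) : ubound (essran (X 0)) r ->
  {ae P, forall w, forall n, (X n w <= r)%R}.
Proof.
move=> hr; apply/ae_foralln => n.
pose J (q : rat * rat) : set R := [set x | (ratr q.1 < x < ratr q.2)%R].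
have mJ q : measurable (J q).
  by have := measurable_itv `](ratr q.1 : R), (ratr q.2 : R)[; rewrite set_itvoo.
pose N q := if P (X n @^-1` J q) == 0 then X n @^-1` J q else set0.
pose F k := if unpickle k is Some q then N q else set0.
have FE q : F (pickle q) = N q by rewrite /F pickleK.
have N0 : P.-negligible (\bigcup_k F k).
  apply: negligible_bigcup => k; rewrite /F; case: unpickle => [q|]; last exact: negligible_set0.
  rewrite /N; case: ifP => [/eqP h|_]; last exact: negligible_set0.
  apply/negligibleP => //; rewrite -[X in measurable X]setTI; exact: measurable_funPT.
apply: negligibleS N0 => w /= /negP; rewrite -ltNge => rw.
have : ~ essran (X 0) (X n w) by move=> /hr; rewrite leNgt rw.
move=> /existsNP[U /not_implyP[oU /not_implyP[Uw /negP]]]; rewrite -leNgt measure_le0 => /eqP U0.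
have [eps eps0 hU] : exists2 eps : R, (0 < eps)%R &
    forall y, (`|X n w - y| < eps)%R -> U y.
  have /nbhs_ballP[eps eps0 hU] : nbhs (X n w) U by move: oU; rewrite openE; exact.
  by exists eps => // y; exact: hU.
have [|q1] := @rat_in_itvoo R (X n w - eps)%R (X n w); first by rewrite ltrBlDl ltrDr.
rewrite in_itv/= => /andP[q1l q1r].
have [|q2] := @rat_in_itvoo R (X n w) (X n w + eps)%R; first by rewrite ltrDl.
rewrite in_itv/= => /andP[q2l q2r].
apply: (ex_intro2 _ _ (pickle (q1, q2)) I); rewrite FE {F FE} /N ifT; first by rewrite /J /= q1r.
apply/eqP/eqP; rewrite -measure_le0 -U0.
apply: (@le_trans _ _ (distribution P (X 0) (J (q1, q2)))).
  by rewrite -(X_id n (mJ _)).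
apply: le_measure; rewrite ?inE//; first exact: open_measurable.
move=> y /= /andP[y1 y2]; apply: hU; rewrite ltr_norml; apply/andP; split; lra.
Qed.

End RandomWeights.

(** * Random weighted shifts *)

Section HasProb.
Context {d : measure_display} {Omega : measurableType d} {R : realType}.
Variable P : probability Omega R.

Lemma has_prob1 (E : set Omega) : {ae P, forall w, E w} -> has_prob P E 1%E.
Proof.
move=> hE; exists setT; split; [exact: measurableT| | |exact: probability_setT].
- by rewrite setDT; exact: negligible_set0.
- by rewrite setTD.
Qed.

Lemma has_prob0 (E : set Omega) : {ae P, forall w, ~ E w} -> has_prob P E 0%E.
Proof.
move=> hE; exists set0; split; [exact: measurable0| | |exact: measure0].
- by rewrite setD0; apply: negligibleS hE => w Ew /(_ Ew).
- by rewrite set0D; exact: negligible_set0.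
Qed.

End HasProb.

Theorem theorem9p1 (R : realType)
    (V : completeNormedModType R[i]) (dot : {dot V for Num.conj})
    (hdot : induces_norm dot) (e : nat -> V) (he : orthonormal_basis dot e)
    (d : measure_display) (Omega : measurableType d) (P : probability Omega R)
    (X : nat -> {RV P >-> R})
    (hX_ge0 : forall n, {ae P, forall w, 0 <= X n w})
    (hX_bounded : exists M : R, forall n, {ae P, forall w, X n w <= M})
    (hX_id : identically_distributed X)
    (hX_indep : mutually_independent X)
    (T Ts : Omega -> {linear V -> V})
    (hT : {ae P, forall w, weighted_shift e (fun n => X n w) (T w)})
    (hTs : {ae P, forall w, is_adjoint dot (T w) (Ts w)})
    (hX_nondeg : nondegenerate_rv (X 0%N))
    (hX_neq0 : P [set w | X 0%N w = 0] = 0%E)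
    (r : R) (hr : essran (X 0%N) r) (hr_max : ubound (essran (X 0%N)) r) :
  let Eln := ('E_P[fun w => ln (X 0%N w)])%E in
  [/\ {ae P, forall w, supercyclic (Ts w)},
      ((0 <= Eln)%E -> has_prob P [set w | hypercyclic (Ts w)] 1%E) /\
      ((Eln < 0)%E -> has_prob P [set w | hypercyclic (Ts w)] 0%E),
      (1 < r -> has_prob P [set w | li_yorke_chaotic (Ts w)] 1%E) /\
      (r <= 1 -> has_prob P [set w | li_yorke_chaotic (Ts w)] 0%E),
      ((0 < Eln)%E -> has_prob P [set w | topologically_mixing (Ts w)] 1%E) /\
      ((Eln <= 0)%E -> has_prob P [set w | topologically_mixing (Ts w)] 0%E)
    & exists p : \bar R,
      [/\ has_prob P [set w | chaotic (Ts w)] p,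
          has_prob P [set w | frequently_hypercyclic (Ts w)] p,
          (0 < Eln)%E -> p = 1%E
        & (Eln <= 0)%E -> p = 0%E] ].
Proof.
move=> Eln.
have [M [M_ge1 X_le]] : exists M : R, 1 <= M /\ forall n, {ae P, forall w, X n w <= M}.
  have [M hM] := hX_bounded; exists (Num.max 1 M); split; first by rewrite le_max lexx.
  by move=> n; apply: filterS (hM n) => w /le_trans; apply; rewrite le_max lexx orbT.
have X_gt0 := weights_gt0 hX_id hX_ge0 hX_neq0.
have bound (K : R) : 0 <= K -> (forall n, {ae P, forall w, X n w <= K}) ->
    {ae P, forall w, forall x, rnorm (Ts w x) <= K * rnorm x}.
  move=> K0 /ae_foralln XK; apply: filterS2 (filterI hT hTs) (filterI X_gt0 XK).
  move=> w [sT aTs] [X0 XKw]; apply: adjoint_bound aTs => //.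
  by apply: (weighted_shift_bound hdot he) sT => n; rewrite ltW//=.
pose good w := [/\ forall n, 0 < X n w, forall n, X n w <= M,
  forall n x, coord dot e n (Ts w x) = (X n w)%:C * coord dot e n.+1 x &
  forall x, rnorm (Ts w x) <= M * rnorm x].
have all_good : {ae P, forall w, good w}.
  have coordTs : {ae P, forall w, forall n x,
      coord dot e n (Ts w x) = (X n w)%:C * coord dot e n.+1 x}.
    by apply: filterS2 hT hTs => w; exact: adjoint_coord.
  have /ae_foralln X_leM := X_le.
  have M0 : 0 <= M by exact: le_trans M_ge1.
  apply: filterS2 (filterI X_gt0 X_leM) (filterI coordTs (bound M M0 X_le)).
  by move=> w [? ?] [? ?].
have ElnE := expectation_ln X; rewrite -/Eln in ElnE.
set Ep := (\int[P]_w (lnpos (X 0%N w))%:E)%E in ElnE.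
set En := (\int[P]_w (lnneg (X 0%N w))%:E)%E in ElnE.
have Ep_fn : Ep \is a fin_num.
  rewrite ge0_fin_numE; first exact: (Elnpos_fin hX_id hX_ge0 M_ge1 X_le hX_neq0).
  by apply: integral_ge0 => w _; rewrite lee_fin lnpos_ge0.
have En_ge0 : (0 <= En)%E by apply: integral_ge0 => w _; rewrite lee_fin lnneg_ge0.
have [En_pos En_neg En_zero] : [/\ (0 < Eln)%E -> (En < Ep)%E, (Eln < 0)%E -> (Ep < En)%E
    & Eln = 0%E -> Ep = En].
  rewrite ElnE -(fineK Ep_fn); move: (fine Ep) En En_ge0 {ElnE} => x [y||]// _.
    rewrite -EFinB !lte_fin subr_gt0 subr_lt0; split=> // -[/eqP].
    by rewrite subr_eq0 => /eqP ->.
  by split=> //; rewrite ltry.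
have growth := weights_growth hX_id hX_indep hX_ge0 M_ge1 X_le hX_neq0.
have decay := weights_decay hX_id hX_indep hX_ge0 M_ge1 X_le hX_neq0.
have oscillate := weights_oscillate hX_id hX_indep hX_ge0 M_ge1 X_le hX_neq0 hX_nondeg.
have inf0 : (Eln <= 0)%E -> {ae P, forall w, ~ exists2 delta : R, 0 < delta &
    exists N, forall n, (N <= n)%N -> delta <= wprod (fun n => X n w) n}.
  rewrite le_eqVlt => /orP[/eqP/En_zero/oscillate[_]|/En_neg/decay].
    by apply: filterS2 X_gt0 => w; exact: wprod_not_bounded_below.
  apply: filterS2 X_gt0 => w w0 [C [eps [eps0 hC]]].
  apply: (wprod_not_bounded_below w0) => C'.
  pose n := (Num.trunc ((C + C') / eps)).+1; exists n.
  have := truncnS_gt ((C + C') / eps); rewrite -/n ltr_pdivrMr// => hn.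
  by apply: (le_lt_trans (hC n)); lra.
split.
- by apply: filterS all_good => w [w0 wM wc wB]; exact: (supercyclic_shift hdot he w0 M_ge1 wc wB).
- split.
    rewrite le_eqVlt => /orP[/eqP/esym/En_zero/oscillate[h _]|/En_pos/growth h].
      apply: has_prob1; apply: filterS2 all_good h => w [w0 wM wc wB] h.
      exact: (hypercyclic_shift hdot he w0 wM M_ge1 wc wB (wprod_frequently_large w0 h)).
    apply: has_prob1; apply: filterS2 all_good h => w [w0 wM wc wB] [c [a [c0 a1 h]]].
    apply: (hypercyclic_shift hdot he w0 wM M_ge1 wc wB) => K N.
    have [N' hN'] := wprod_cvgy c0 a1 h K.
    by exists (maxn N N'); [exact: leq_maxl|apply: hN'; exact: leq_maxr].
  move=> /En_neg/decay h; apply: has_prob0.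
  apply: filterS2 all_good h => w [w0 wM wc wB] [C [eps [eps0 h]]].
  apply: (not_hypercyclic_shift hdot he w0 wc (K := expR C)) => n.
  rewrite wprod_expR// ler_expR (le_trans (h n))// gerBl.
  by rewrite mulr_ge0// ltW.
- split=> r1.
    apply: has_prob1.
    have h := weights_long_blocks hX_id hX_indep hX_ge0 hX_neq0 hr r1.
    apply: filterS2 all_good h => w [w0 wM wc wB].
    exact: (li_yorke_shift hdot he w0 wM M_ge1 wc wB).
  apply: has_prob0; have Xr := weights_le_essran hX_id hr_max.
  have X1 n : {ae P, forall w, X n w <= 1}.
    by apply: filterS Xr => w /(_ n) /le_trans; exact.
  apply: filterS (bound 1 ler01 X1) => w h; apply: not_li_yorke_contraction => x.
  by rewrite -[leRHS]mul1r.
- split=> [/En_pos/growth h|/inf0 h].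
    apply: has_prob1; apply: filterS2 all_good h => w [w0 wM wc wB] [c [a [c0 a1 h]]].
    exact: (mixing_shift hdot he w0 wc (wprod_cvgy c0 a1 h)).
  apply: has_prob0; apply: filterS2 all_good h => w [w0 wM wc wB] h.
  by move=> /(mixing_inf_gt0 hdot he w0 wc).
have [Eln0|Eln0] := leP Eln 0%E.
  exists 0%E; split=> //.
  - apply: has_prob0; apply: filterS2 all_good (inf0 Eln0) => w [w0 wM wc wB] h ch.
    have [delta delta0 hd] := chaotic_inf_gt0 hdot he w0 wM M_ge1 wc ch.
    by apply: h; exists delta => //; exists 0%N.
  - apply: has_prob0; apply: filterS2 all_good (inf0 Eln0) => w [w0 wM wc wB] h fh.
    have [delta delta0 hd] := frequently_hypercyclic_inf_gt0 hdot he w0 wM M_ge1 wc fh.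
    by apply: h; exists delta => //; exists 0%N.
exists 1%E; split=> //.
- apply: has_prob1; apply: filterS2 all_good (growth (En_pos Eln0)).
  move=> w [w0 wM wc wB] [c [a [c0 a1 h]]].
  exact: (chaotic_shift hdot he w0 M_ge1 wc wB c0 a1 h).
- apply: has_prob1; apply: filterS2 all_good (growth (En_pos Eln0)).
  move=> w [w0 wM wc wB] [c [a [c0 a1 h]]].
  exact: (frequently_hypercyclic_shift hdot he w0 M_ge1 wc wB c0 a1 h).
Qed.
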